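(* Let $\widetilde{G}$ be an $st$-planar graph and let $G$ be a subgraph of $\widetilde{G}$, with edge weights $\mathrm{wt}$ in a commutative ring $\mathcal{R}$. Let $U=\{u_1,\dots,u_n\}$ and $V=\{v_1,\dots,v_n\}$ be two sets of $n$ distinct vertices (marked points) of $G$. Let $M$ be the $n\times n$ matrix whose $(i,j)$-entry is $$\sum_{p\in\mathscr{P}(u_i,v_j)}\operatorname{sgn}(p)\,\mathrm{wt}(p).$$ Then the total weight of families of non-intersecting paths connecting $U$ to $V$ is $$GF(\mathscr{P}_0(U,V))=\sum_{\pi\in\mathfrak{S}_n}GF(\mathscr{P}^{\pi}_0(U,V))=\left|\det M\right|,$$ where $|\det M|$ is understood up to sign, i.e. there is $\varepsilon\in\{1,-1\}$ with $GF(\mathscr{P}_0(U,V))=\varepsilon\det M$ in $\mathcal{R}$.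
   Context: Graphs and weights. A directed graph (digraph) is a simple, connected directed graph; here all graphs are finite. Each edge $e$ of $G$ has a weight $\mathrm{wt}(e)$ in a commutative ring $\mathcal{R}$. Paths are directed. The weight of a path is the product of the weights of its edges (a path of length zero is allowed and has weight $1$); the weight of an $n$-tuple $P=(p_1,\dots,p_n)$ of paths is $\prod_i\mathrm{wt}(p_i)$. For a collection $\mathscr{P}$ of (families of) paths, $GF(\mathscr{P})=\sum_{P\in\mathscr{P}}\mathrm{wt}(P)$. $st$-planar graphs and drawings. An $st$-planar graph is a planar acyclic digraph with exactly one source $s$ (vertex with no incoming edges) and exactly one sink $t$ (vertex with no outgoing edges), both lying on the outer face. $\widetilde{G}$ is taken with a fixed upward planar drawing with $s,t$ on the outer face: every edge is drawn as a line segment that is horizontal or points upward (along its direction), and edges meet only at vertices. ''Left'' refers to this drawing. If $b$ is reachable from $a$ in $\widetilde{G}$, the leftmost path from $a$ to $b$ is the directed path in $\widetilde{G}$ obtained by taking at each stage the leftmost step (among the outgoing edges from which $b$ can still be reached). The left boundary of $\widetilde{G}$ is the directed path from $s$ to $t$ bounding the drawing on the left. Families of paths. $\mathscr{P}(u_i,v_j)$ is the set of paths in $G$ from $u_i$ to $v_j$. For $\pi\in\mathfrak{S}_n$, $\mathscr{P}^{\pi}(U,V)$ is the set of $n$-tuples $(p_1,\dots,p_n)$ with $p_i\in\mathscr{P}(u_i,v_{\pi(i)})$ ($\pi$ is called the connection type), and $\mathscr{P}(U,V)=\bigcup_{\pi}\mathscr{P}^{\pi}(U,V)$. $\mathscr{P}^{\pi}_0(U,V)$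 and $\mathscr{P}_0(U,V)$ are the subsets of non-intersecting $n$-tuples, i.e. those in which no two of the paths share a vertex. Path sign. For a path $p\in\mathscr{P}(u,v)$ in $G$ ($u\in U$, $v\in V$), the left side of $p$ is the closed region of the plane bounded by: the leftmost path in $\widetilde{G}$ from $s$ to $u$, the path $p$ itself, the leftmost path in $\widetilde{G}$ from $v$ to $t$, and the left boundary of $\widetilde{G}$ from $s$ to $t$. $L(p)$ is the collection of marked points of $U\cup V$ lying on the left side of $p$, including $u$ and $v$; a vertex that belongs to both $U$ and $V$ is counted twice in $|L(p)|$ (once as a starting point, once as an ending point). The path sign is $\operatorname{sgn}(p)=(-1)^{|L(p)|}$. *)

(* Defs.v *)
From HB Require Import structures.
From mathcomp Require Import all_boot all_order all_fingroup all_algebra.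
From mathcomp Require Import boolp classical_sets reals topology normedtype.

Set Implicit Arguments.
Unset Strict Implicit.
Unset Printing Implicit Defensive.

Import Order.TTheory GRing.Theory Num.Theory.
Import numFieldNormedType.Exports.

Local Open Scope classical_set_scope.
Local Open Scope ring_scope.

Section Digraph.
Variable T : finType.
Implicit Types (e : rel T) (A : {set T}) (p : seq T).

(* A simple digraph on T is an edge relation; a path is the nonempty sequence
   of its vertices, so that [:: a] is the path of length zero at a. *)
Definition is_path e (a b : T) p : bool :=
  if p is x :: q then [&& x == a, path e x q & last x q == b] else false.

Definition steps p : seq (T * T) := zip p (behead p).

Record st_digraph e (s t : T) : Prop := StDigraph {
  st_connected : forall x y, connect (fun a b => e a b || e b a) x y;
  st_acyclic : forall p, path.cycle e p -> p = [::];
  st_source : forall x, (forall y, ~~ e y x) <-> x = s;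
  st_sink : forall x, (forall y, ~~ e x y) <-> x = t }.

Record subgraph e (A : {set T}) (eG : rel T) : Prop := Subgraph {
  subgraph_edge : forall x y, eG x y -> e x y;
  subgraph_vertices : forall x y, eG x y -> (x \in A) && (y \in A) }.

End Digraph.

Section Plane.
Variable K : realType.
Implicit Types (a b z : K * K) (C : set (K * K)).

Definition segment a b : set (K * K) :=
  [set z | exists2 r : K, 0 <= r <= 1 & z = a + r *: (b - a)].

(* The union of the unbounded connected components of the complement of C. *)
Definition outer_face C : set (K * K) :=
  [set z | ~ C z /\ ~ bounded_set (connected_component (~` C) z)].

(* The closed region bounded by the curves making up C: these curves together
   with the bounded components of their complement. *)
Definition enclosed_region C : set (K * K) := ~` outer_face C.

End Plane.

Section Drawing.
Variables (K : realType) (T : finType) (e : rel T) (pos : T -> K * K).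
Implicit Types (a b x y z : T) (p : seq T).

Definition drawing : set (K * K) :=
  range pos `|` [set w | exists x y, e x y /\ segment (pos x) (pos y) w].

Definition curve p : set (K * K) :=
  [set w | exists2 x, x \in p & w = pos x] `|`
  [set w | exists2 xy, xy \in steps p & segment (pos xy.1) (pos xy.2) w].

Record upward_planar_drawing : Prop := UpwardPlanarDrawing {
  pos_inj : injective pos;
  edge_upward : forall x y, e x y -> (pos x).2 <= (pos y).2;
  edge_vertex : forall x y z,
    e x y -> segment (pos x) (pos y) (pos z) -> z = x \/ z = y;
  edge_edge : forall x y x' y' w, e x y -> e x' y' -> (x, y) <> (x', y') ->
    segment (pos x) (pos y) w -> segment (pos x') (pos y') w ->
    exists z, [/\ w = pos z, z = x \/ z = y & z = x' \/ z = y'] }.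

(* For edges x -> y and x -> z: the direction of x -> y is strictly
   counterclockwise from that of x -> z, both having angle in [0, pi]. The
   second disjunct is the case of two opposite horizontal edges, for which the
   cross product vanishes. *)
Definition left_of x y z : bool :=
  let d := pos y - pos x in let d' := pos z - pos x in
  let cross := d'.1 * d.2 - d'.2 * d.1 in
  (0 < cross) || (cross == 0) && (d.1 < d'.1).

Definition is_leftmost_path a b p : Prop :=
  is_path e a b p /\
  forall x y, (x, y) \in steps p ->
  forall z, e x z -> connect e z b -> z = y \/ left_of x y z.

Definition leftmost_path a b : seq T :=
  xget [::] [set p | is_leftmost_path a b p].

(* No point of the drawing lies horizontally to the left of the path p. *)
Definition is_left_boundary s t p : Prop :=
  is_path e s t p /\
  forall w, drawing w -> exists2 w', curve p w' & w'.2 = w.2 /\ w'.1 <= w.1.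

Definition left_boundary s t : seq T :=
  xget [::] [set p | is_left_boundary s t p].

Definition left_side s t a b p : set (K * K) :=
  enclosed_region (curve (leftmost_path s a) `|` curve p
    `|` curve (leftmost_path b t) `|` curve (left_boundary s t)).

End Drawing.

(* An st-planar graph together with its fixed upward drawing. *)
Record st_planar (K : realType) (T : finType) (e : rel T) (s t : T)
    (pos : T -> K * K) : Prop := StPlanar {
  st_planar_digraph : st_digraph e s t;
  st_planar_drawing : upward_planar_drawing e pos;
  st_planar_source : closure (outer_face (drawing e pos)) (pos s);
  st_planar_sink : closure (outer_face (drawing e pos)) (pos t) }.

Section PathSign.
Variables (K : realType) (T : finType) (e : rel T) (s t : T).
Variables (pos : T -> K * K) (n : nat) (u v : 'I_n -> T).

(* |L(p)| for a path p from a to b: starting points and ending points are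
   counted separately. *)
Definition num_left (a b : T) (p : seq T) : nat :=
  (#|[pred i | `[< left_side e pos s t a b p (pos (u i)) >]]| +
  #|[pred i | `[< left_side e pos s t a b p (pos (v i)) >]]|)%N.

Definition path_sign (R : comPzRingType) (a b : T) (p : seq T) : R :=
  (-1) ^+ num_left a b p.

End PathSign.

Section PathFamilies.
Variables (T : finType) (eG : rel T).

(* In an acyclic digraph on T every path has at most #|T| vertices. *)
Definition vpath : finType := #|T|.-bseq T.

Definition paths (a b : T) : {set vpath} := [set p : vpath | is_path eG a b p].

Variables (n : nat) (u v : 'I_n -> T).
Implicit Types (sigma : 'S_n) (P : {ffun 'I_n -> vpath}).

Definition families_of_type sigma : {set {ffun 'I_n -> vpath}} :=
  [set P : {ffun 'I_n -> vpath} | [forall i, P i \in paths (u i) (v (sigma i))]].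

Definition families : {set {ffun 'I_n -> vpath}} :=
  \bigcup_sigma families_of_type sigma.

Definition nonintersecting P : bool :=
  [forall i, forall j, (i != j) ==> [disjoint P i & P j]].

Definition families_of_type0 sigma : {set {ffun 'I_n -> vpath}} :=
  [set P in families_of_type sigma | nonintersecting P].

Definition families0 : {set {ffun 'I_n -> vpath}} :=
  [set P in families | nonintersecting P].

Variables (R : comPzRingType) (wt : T -> T -> R).

Definition path_weight (p : seq T) : R := \prod_(xy <- steps p) wt xy.1 xy.2.

Definition GF (F : {set {ffun 'I_n -> vpath}}) : R :=
  \sum_(P in F) \prod_i path_weight (P i).

End PathFamilies.

Definition signed_path_matrix (K : realType) (T : finType) (e : rel T)
    (s t : T) (pos : T -> K * K) (eG : rel T) (R : comPzRingType)
    (wt : T -> T -> R) (n : nat) (u v : 'I_n -> T) : 'M[R]_n :=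
  \matrix_(i, j) \sum_(p in paths eG (u i) (v j))
    path_sign e s t pos u v R (u i) (v j) p * path_weight wt p.

(* Main.v *)
(**
The leftmost paths only complete a path p from u to v to a path Q from s to t,
and the left side of p is the set of points lying at or to the left of some
point of Q at the same height. Write l(w, p) for the truth value of "some point
of p lies at the same height as w, weakly to its right". Modulo 2, l(w, -) is
additive under concatenation up to the contribution of the common vertex, so
sgn(p) = c(u) d(v) eps(p), where eps(p) is the product of (-1)^l(w, p) over all
marked points w and satisfies eps(p) eps(q) = eps(p') eps(q') whenever (p', q')
arises from (p, q) by exchanging tails at a common vertex. Tail exchange thus
cancels the intersecting families in the expansion of the determinant.

For disjoint paths p : u -> v and p' : u' -> v', one of them is to the left of
the other at all heights which they share. Hence the parity of
l(u', p) + l(v', p) + l(u, p') + l(v, p') depends only on the relative heights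
of the four end points: it is
1 + [u < u'] + [v < v'] + [v below u'] + [v' below u]. Summed over all pairs of
paths of a non-intersecting family of type pi, the terms [v < v'] give the sign
of pi up to a constant, and all other terms give constants.
*)

Require Import Defs.
From mathcomp Require Import all_boot all_order all_fingroup all_algebra.
From mathcomp Require Import boolp classical_sets reals topology.
From mathcomp Require Import prodnormedzmodule normedtype ring lra.

Set Implicit Arguments.
Unset Strict Implicit.
Unset Printing Implicit Defensive.

Import Order.TTheory GRing.Theory Num.Theory.
Import numFieldNormedType.Exports ProdNormedZmodule.Exports.

Local Open Scope classical_set_scope.
Local Open Scope ring_scope.

(** * Horizontal sides of compact plane sets *)

(** Tube lemma: for [y] outside, each [x] of [C] has a neighbourhood of [(x, y)] missing [P], and
    compactness of [C] makes one neighbourhood of [y] serve all [x]. *)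
Lemma closed_proj_compact (X Y : topologicalType) (C : set X)
    (P : set (X * Y)) :
  compact C -> closed P -> closed [set y | exists2 x, C x & P (x, y)].
Proof.
move=> /compact_near_coveringP cC cP.
rewrite -[X in closed X]setCK closedC openE => y ny.
have : nbhs y (fun y' => C `<=` (fun x => ~ P (x, y'))).
  apply: (cC _ (nbhs y) (fun y' x => ~ P (x, y'))) => x Cx.
  have : nbhs (x, y) (~` P).
    apply: open_nbhs_nbhs; split; first by rewrite openC.
    by move=> Pxy; apply: ny; exists x.
  by apply: filterS => -[].
by apply: filterS => y' h [x Cx]; exact: h.
Qed.

Section HorizontalSides.
Variable K : realType.
Implicit Types (B C S : set (K * K)) (z c : K * K) (y : K).

(** Sides are taken height by height and are weak: a point of [C] lies on both sides of [C]. *)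
Definition leftward C : set (K * K) :=
  [set z | exists2 c, C c & c.2 = z.2 /\ z.1 <= c.1].

Definition rightward C : set (K * K) :=
  [set z | exists2 c, C c & c.2 = z.2 /\ c.1 <= z.1].

Lemma sub_leftward C : C `<=` leftward C.
Proof. by move=> c Cc; exists c. Qed.

Lemma sub_rightward C : C `<=` rightward C.
Proof. by move=> c Cc; exists c. Qed.

Let continuous_diff (f g : (K * K) * (K * K) -> K) :
  continuous f -> continuous g -> continuous (fun w => f w - g w).
Proof. by move=> cf cg w; apply: cvgB; [exact: cf | exact: cg]. Qed.

Let continuous_fst1 : continuous (fun w : (K * K) * (K * K) => w.1.1).
Proof. by move=> w; apply: (@cvg_comp _ _ _ fst fst); exact: cvg_fst. Qed.

Let continuous_fst2 : continuous (fun w : (K * K) * (K * K) => w.1.2).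
Proof. by move=> w; apply: (@cvg_comp _ _ _ fst snd); [exact: cvg_fst | exact: cvg_snd]. Qed.

Let continuous_snd1 : continuous (fun w : (K * K) * (K * K) => w.2.1).
Proof. by move=> w; apply: (@cvg_comp _ _ _ snd fst); [exact: cvg_snd | exact: cvg_fst]. Qed.

Let continuous_snd2 : continuous (fun w : (K * K) * (K * K) => w.2.2).
Proof. by move=> w; apply: (@cvg_comp _ _ _ snd snd); exact: cvg_snd. Qed.

Lemma closed_leftward C : compact C -> closed (leftward C).
Proof.
move=> cC; apply: (@closed_proj_compact _ _ C
  [set w : (K * K) * (K * K) | w.1.2 = w.2.2 /\ w.2.1 <= w.1.1]) => //.
have -> : [set w : (K * K) * (K * K) | w.1.2 = w.2.2 /\ w.2.1 <= w.1.1] =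
    (fun w : (K * K) * (K * K) => w.1.2 - w.2.2) @^-1` [set r | r = 0] `&`
    (fun w : (K * K) * (K * K) => w.2.1 - w.1.1) @^-1` [set r | r <= 0].
  apply/seteqP; split=> w /=.
    by case=> -> h; split; rewrite ?subrr ?subr_le0.
  by case=> /eqP; rewrite subr_eq0 => /eqP h; rewrite subr_le0.
by apply: closedI; [apply: (iffLR (continuous_closedP _)) (@closed_eq K 0)
  | apply: (iffLR (continuous_closedP _)) (@closed_le K 0)]; apply: continuous_diff.
Qed.

Lemma closed_rightward C : compact C -> closed (rightward C).
Proof.
move=> cC; apply: (@closed_proj_compact _ _ C
  [set w : (K * K) * (K * K) | w.1.2 = w.2.2 /\ w.1.1 <= w.2.1]) => //.
have -> : [set w : (K * K) * (K * K) | w.1.2 = w.2.2 /\ w.1.1 <= w.2.1] =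
    (fun w : (K * K) * (K * K) => w.1.2 - w.2.2) @^-1` [set r | r = 0] `&`
    (fun w : (K * K) * (K * K) => w.1.1 - w.2.1) @^-1` [set r | r <= 0].
  apply/seteqP; split=> w /=.
    by case=> -> h; split; rewrite ?subrr ?subr_le0.
  by case=> /eqP; rewrite subr_eq0 => /eqP h; rewrite subr_le0.
by apply: closedI; [apply: (iffLR (continuous_closedP _)) (@closed_eq K 0)
  | apply: (iffLR (continuous_closedP _)) (@closed_le K 0)]; apply: continuous_diff.
Qed.

End HorizontalSides.

(** * Monotone polygonal paths *)

Section Polyline.
Variables (K : realType) (T : finType) (pos : T -> K * K).
Implicit Types (x y z : T) (p q : seq T) (r a b : K).

Lemma segment_start (a b : K * K) : segment a b a.
Proof. by exists 0; rewrite ?lexx ?ler01// scale0r addr0. Qed.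

Lemma segment_end (a b : K * K) : segment a b b.
Proof. by exists 1; rewrite ?lexx ?ler01// scale1r addrC subrK. Qed.

Lemma segmentC (a b w : K * K) : segment a b w -> segment b a w.
Proof.
case=> r h ->; exists (1 - r); first lra.
by rewrite scalerBl scale1r !scalerBr opprB; ring.
Qed.

Lemma curve1 x : curve pos [:: x] = [set pos x].
Proof.
apply/seteqP; split=> w.
  by case=> [[y]|[]//]; rewrite inE => /eqP-> ->.
by move=> ->; left; exists x; rewrite ?inE.
Qed.

Lemma curve_cons x y q :
  curve pos (x :: y :: q) = segment (pos x) (pos y) `|` curve pos (y :: q).
Proof.
apply/seteqP; split=> w.
- case=> [[z]|[[z t]]].
    rewrite inE => /orP[/eqP-> ->|zq ->]; first by left; exact: segment_start.
    by right; left; exists z.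
  rewrite /steps /= inE => /orP[/eqP[-> ->]|h] s; first by left.
  by right; right; exists (z, t).
- case=> [s|[[z zq ->]|[zt h s]]].
  + by right; exists (x, y) => //; rewrite /steps /= inE eqxx.
  + by left; exists z => //; rewrite inE zq orbT.
  + by right; exists zt => //; rewrite /steps /= inE h orbT.
Qed.

Lemma curve_vertex x p : x \in p -> curve pos p (pos x).
Proof. by move=> xp; left; exists x. Qed.

Lemma curve_cat x q q' :
  curve pos (x :: q ++ q') = curve pos (x :: q) `|` curve pos (last x q :: q').
Proof.
elim: q x => [|y q IH] x /=.
  rewrite curve1 setUidr// => w ->; apply: curve_vertex; exact: mem_head.
by rewrite !curve_cons IH setUA.
Qed.

Definition clamp r : K := Num.max 0 (Num.min 1 r).

(** Parametrises [curve] on the interval from 0 to [size q], one unit of time per edge, and is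
    constant outside. During the first unit the recursive term rests at [pos y] and the correction
    leads there from [pos x]; later the correction vanishes. As a sum of clamped terms it is
    continuous without any gluing. *)
Fixpoint polyline x q : K -> K * K :=
  if q is y :: q' then
    fun r => polyline y q' (r - 1) + (clamp r - 1) *: (pos y - pos x)
  else fun=> pos x.

Lemma clamp_homo r r' : r <= r' -> clamp r <= clamp r'.
Proof.
move=> h; rewrite /clamp ge_max !le_max !le_min !ge_min !lexx h !ler01 /=.
by rewrite !orbT.
Qed.

Lemma clamp_le0 r : r <= 0 -> clamp r = 0.
Proof. by move=> h; apply/max_idPl; rewrite ge_min h orbT. Qed.

Lemma clamp_ge1 r : 1 <= r -> clamp r = 1.
Proof. by move=> /min_idPl h; rewrite /clamp h; apply/max_idPr; exact: ler01. Qed.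

Lemma clamp_id r : 0 <= r <= 1 -> clamp r = r.
Proof.
by move=> /andP[h0 h1]; rewrite /clamp (min_idPr h1); apply/max_idPr.
Qed.

Lemma polyline_continuous x q : continuous (polyline x q).
Proof.
have cclamp : continuous (clamp : K -> K).
  move=> r; rewrite /clamp; apply: (@continuous_max K K (fun=> 0)).
    exact: cvg_cst.
  by apply: (@continuous_min K K (fun=> 1)); [exact: cvg_cst | exact: cvg_id].
elim: q x => [|y q IH] x r /=; first exact: cvg_cst.
apply: cvgD.
  apply: (@cvg_comp _ _ _ (fun r => r - 1) (polyline y q)); last exact: IH.
  by apply: cvgB; [exact: cvg_id | exact: cvg_cst].
apply: cvgZr_tmp; apply: cvgB; [exact: cclamp | exact: cvg_cst].
Qed.

Lemma polyline_le0 x q r : r <= 0 -> polyline x q r = pos x.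
Proof.
elim: q x r => [|y q IH] x r r0 //=.
rewrite IH; last lra.
by rewrite clamp_le0// sub0r scaleN1r opprB addrC subrK.
Qed.

Lemma polyline_ge x q r : (size q)%:R <= r -> polyline x q r = pos (last x q).
Proof.
elim: q x r => [|y q IH] x r //=; rewrite -natr1 => r0.
have : 0 <= (size q)%:R :> K by rewrite ler0n.
move=> h; rewrite IH; last lra.
by rewrite clamp_ge1 ?subrr ?scale0r ?addr0//; lra.
Qed.

Lemma polyline_first x y q r : 0 <= r <= 1 ->
  polyline x (y :: q) r = pos x + r *: (pos y - pos x).
Proof.
move=> h /=; rewrite polyline_le0; last lra.
by rewrite clamp_id// scalerBl scale1r opprB addrCA [X in _ + X]addrC subrK addrC.
Qed.

Lemma polyline_later x y q r : 1 <= r ->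
  polyline x (y :: q) r = polyline y q (r - 1).
Proof. by move=> h /=; rewrite clamp_ge1// subrr scale0r addr0. Qed.

Lemma curve_polylineP x q w :
  curve pos (x :: q) w <-> exists2 r, 0 <= r <= (size q)%:R & w = polyline x q r.
Proof.
elim: q x w => [|y q IH] x w.
  rewrite curve1; by split=> [->|[r _ ->]//]; exists 0; rewrite ?lexx.
rewrite curve_cons /= -natr1.
have s0 : 0 <= (size q)%:R :> K by rewrite ler0n.
split=> [[[r h ->]|/IH[r h ->]]|[r h ->]].
- exists r; first lra.
  by rewrite -(@polyline_first _ _ q).
- exists (r + 1); first lra.
  by rewrite -[RHS]/(polyline x (y :: q) (r + 1)) polyline_later ?addrK//; lra.
- rewrite -[_ + _]/(polyline x (y :: q) r).
  case: (leP r 1) => r1.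
    by left; exists r; rewrite ?polyline_first//; lra.
  right; apply/IH; exists (r - 1); first lra.
  by rewrite polyline_later//; lra.
Qed.

Lemma curve_range x q : curve pos (x :: q) = range (polyline x q).
Proof.
apply/seteqP; split=> w; first by move=> /curve_polylineP[r _ ->]; exists r.
case=> r _ <-; apply/curve_polylineP.
have s0 : 0 <= (size q)%:R :> K by rewrite ler0n.
case: (leP r 0) => r0.
  by exists 0; rewrite ?polyline_le0 ?lexx.
case: (leP (size q)%:R r) => rs.
  by exists (size q)%:R; rewrite ?s0 ?lexx// !polyline_ge.
by exists r => //; rewrite !ltW.
Qed.

(** Integer times give the first case, all others the second; [behead (belast x q)] lists the inner
    vertices. *)
Lemma polyline_interior x q r : 0 < r < (size q)%:R ->
  (exists2 z, z \in behead (belast x q) & polyline x q r = pos z) \/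
  (exists2 yz, yz \in steps (x :: q) & exists2 r', 0 < r' < 1 &
    polyline x q r = pos yz.1 + r' *: (pos yz.2 - pos yz.1)).
Proof.
elim: q x r => [|y q IH] x r; first by rewrite /=; lra.
rewrite [size _]/= -natr1 => h.
case: (ltgtP r 1) => r1.
- right; exists (x, y); first by rewrite /steps /= mem_head.
  by exists r; rewrite ?polyline_first//; lra.
- rewrite polyline_later; last lra.
  have [|[z zq ->]|[yz yzq [r' h' ->]]] := IH y (r - 1); first lra.
    left; exists z => //; move: zq; case: (q) => //= a q'; rewrite inE => ->.
    by rewrite orbT.
  by right; exists yz; [rewrite /steps /= inE yzq orbT | exists r'].
- left; exists y.
    by move: h; rewrite r1; case: (q) => [|a q'] /=; [lra | rewrite mem_head].
  by rewrite r1 polyline_later ?lexx// subrr polyline_le0.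
Qed.

Lemma polyline_homo2 (e : rel T) x q :
  (forall x y, e x y -> (pos x).2 <= (pos y).2) -> path e x q ->
  {homo (fun r => (polyline x q r).2) : r r' / r <= r'}.
Proof.
move=> up; elim: q x => [|y q IH] x /=; first by move=> _ r r' _.
move=> /andP[exy pq] r r' h.
have := IH y pq (r - 1) (r' - 1); rewrite lerD2r => /(_ h) h1.
have h2 := clamp_homo h; have h3 := up _ _ exy.
by apply: lerD => //; rewrite /= ler_wpM2r ?subr_ge0 ?lerD2r.
Qed.

Lemma curve_compact x q : compact (curve pos (x :: q)).
Proof.
have -> : curve pos (x :: q) = polyline x q @` `[0, (size q)%:R].
  apply/seteqP; split=> w.
    by move=> /curve_polylineP[r h ->]; exists r.
  by case=> r h <-; apply/curve_polylineP; exists r.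
apply: continuous_compact; last exact: segment_compact.
by apply: continuous_subspaceT; exact: polyline_continuous.
Qed.

Lemma polyline_connected x q (J : set K) :
  is_interval J -> connected (polyline x q @` J).
Proof.
move=> /connected_intervalP cJ; apply: connected_continuous_connected => //.
by apply: continuous_subspaceT; exact: polyline_continuous.
Qed.

Variable e : rel T.
Hypothesis up : forall x y, e x y -> (pos x).2 <= (pos y).2.

Lemma curve_height x q w : path e x q -> curve pos (x :: q) w ->
  (pos x).2 <= w.2 <= (pos (last x q)).2.
Proof.
move=> pq /curve_polylineP[r /andP[h1 h2] ->].
have m := polyline_homo2 up pq.
apply/andP; split.
  by have := m _ _ h1; rewrite /= (polyline_le0 x q (lexx 0)).
by have := m _ _ h2; rewrite /= (polyline_ge x (lexx _)).
Qed.

Lemma curve_cover x q a : path e x q ->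
  (pos x).2 <= a <= (pos (last x q)).2 -> exists2 c, curve pos (x :: q) c & c.2 = a.
Proof.
move=> pq h.
have [|||r _ hr] := @IVT K (fun r => (polyline x q r).2) 0 (size q)%:R a.
- by rewrite ler0n.
- apply: continuous_subspaceT => r.
  by apply: (@cvg_comp _ _ _ (polyline x q) snd); [exact: polyline_continuous|exact: cvg_snd].
- rewrite (polyline_le0 x q (lexx 0)) (polyline_ge x (lexx _)).
  by case/andP: h => h1 h2; rewrite ge_min le_max h1 h2 orbT.
by exists (polyline x q r) => //; rewrite curve_range; exists r.
Qed.

(** Height is monotone in time, so between the times of [c] and [d] the path stays at the height of
    [z]; the intermediate value theorem for the abscissa then reaches [z]. *)
Lemma curve_slice x q (c d z : K * K) : path e x q ->
  curve pos (x :: q) c -> curve pos (x :: q) d -> c.2 = z.2 -> d.2 = z.2 ->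
  c.1 <= z.1 <= d.1 -> curve pos (x :: q) z.
Proof.
move=> pq; rewrite !curve_range => -[r _ <-] [r' _ <-].
have m := polyline_homo2 up pq.
have cont : continuous (fun r => (polyline x q r).1).
  move=> ?.
  by apply: (@cvg_comp _ _ _ (polyline x q) fst); [exact: polyline_continuous|exact: cvg_fst].
have sol (a b v : K) : a <= b -> (polyline x q a).2 = z.2 -> (polyline x q b).2 = z.2 ->
    Num.min (polyline x q a).1 (polyline x q b).1 <= v
      <= Num.max (polyline x q a).1 (polyline x q b).1 ->
    exists t, polyline x q t = (v, z.2).
  move=> ab ha hb hv.
  have [||t /= ht tv] := @IVT K (fun r => (polyline x q r).1) a b v ab.
  - exact: continuous_subspaceT.
  - exact: hv.
  exists t; rewrite -tv [LHS]surjective_pairing; congr (_, _).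
  move: ht; rewrite in_itv/= => /andP[h1 h2].
  apply/eqP; rewrite eq_le -{1}hb -{1}ha.
  by apply/andP; split; [have := m _ _ h2 | have := m _ _ h1].
move=> h2 h2' /andP[h1 h1'].
suff [t tz] : exists t, polyline x q t = z by exists t.
rewrite [z]surjective_pairing.
case: (leP r r') => rr; [apply: (sol r r') | apply: (sol r' r)] => //.
- by rewrite ge_min le_max h1 h1' orbT.
- exact: ltW.
- by rewrite ge_min le_max h1 h1' !orbT.
Qed.

(** By monotonicity of the height, the times spent in the slab form an interval. *)
Lemma curve_slab_connected x q a b : path e x q ->
  connected (curve pos (x :: q) `&` [set z | a <= z.2 <= b]).
Proof.
move=> pq; have m := polyline_homo2 up pq.
have -> : curve pos (x :: q) `&` [set z | a <= z.2 <= b] =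
    polyline x q @` [set r | a <= (polyline x q r).2 <= b].
  rewrite curve_range; apply/seteqP; split=> w; first by case=> -[r _ <-] h; exists r.
  by case=> r h <-; split => //; exists r.
apply: polyline_connected => r r' /= /andP[h1 h2] /andP[h3 h4] s /andP[h5 h6].
by apply/andP; split; [apply: le_trans h1 (m _ _ h5) | apply: le_trans (m _ _ h6) h4].
Qed.

End Polyline.

(** * Paths in planar drawings *)

Section AcyclicPath.
Variables (T : finType) (e : rel T).
Hypothesis acyc : forall p, path.cycle e p -> p = [::].
Implicit Types (x y z : T) (p q : seq T).

Lemma acyclic_edge x y : e x y -> connect e y x = false.
Proof.
move=> exy; apply/negP => /connectP[q pq lq].
(* [path.cycle] takes each vertex of a closed walk once, so [belast] drops the final [x]. *)
suff /acyc : path.cycle e (x :: belast y q) by [].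
by rewrite /= {2}lq -lastI /= exy.
Qed.

Lemma acyclic_irr x : e x x = false.
Proof. by apply/negP => exx; have := acyclic_edge exx; rewrite connect0. Qed.

Lemma path_connect_last x q y : path e x q -> y \in x :: q -> connect e y (last x q).
Proof.
rewrite inE => pq /orP[/eqP->|yq]; first by apply/connectP; exists q.
move: pq; case/splitPr: yq => q1 q2; rewrite cat_path last_cat /= => /and3P[_ _ p2].
by apply/connectP; exists q2.
Qed.

Lemma acyclic_anti x y : connect e x y -> connect e y x -> x = y.
Proof.
case/connectP=> -[|z q] //= /andP[exz pq] -> c.
have := acyclic_edge exz; rewrite (connect_trans _ c)//.
by apply/connectP; exists q.
Qed.

Lemma path_uniq x q : path e x q -> uniq (x :: q).
Proof.
elim: q x => [|y q IH] x // /andP[exy pq].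
rewrite cons_uniq IH// andbT; apply/negP => xq.
have := path_connect pq (xq : x \in y :: q).
by rewrite (acyclic_edge exy).
Qed.

Lemma steps_cons x y q : steps (x :: y :: q) = (x, y) :: steps (y :: q).
Proof. by []. Qed.

Lemma steps_mem p a b : (a, b) \in steps p -> (a \in p) && (b \in behead p).
Proof.
case: p => [|x q] //; elim: q x => [|y q IH] x //.
rewrite steps_cons inE => /orP[/eqP[-> ->]|/IH /andP[h1 h2]].
  by rewrite /= !mem_head.
by rewrite inE h1 orbT /= inE h2 orbT.
Qed.

Lemma steps_edge x q a b : path e x q -> (a, b) \in steps (x :: q) -> e a b.
Proof.
elim: q x => [|y q IH] x //= /andP[exy pq].
by rewrite steps_cons inE => /orP[/eqP[-> ->]|/IH]//; exact.
Qed.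

End AcyclicPath.

Section PlanarDrawing.
Variables (K : realType) (T : finType) (e : rel T) (pos : T -> K * K).
Hypothesis acyc : forall p, path.cycle e p -> p = [::].
Hypothesis dr : upward_planar_drawing e pos.
Implicit Types (x y z : T) (p q : seq T) (S : set (K * K)).

Let up := edge_upward dr.

Lemma leftward_rightward x q w : path e x q ->
  leftward (curve pos (x :: q)) w -> rightward (curve pos (x :: q)) w ->
  curve pos (x :: q) w.
Proof.
move=> pq [c cc [c2 wc]] [d cd [d2 dw]].
by apply: (curve_slice up pq cd cc) => //; rewrite dw.
Qed.

Lemma leftward_or_rightward x q (w : K * K) : path e x q ->
  (pos x).2 <= w.2 <= (pos (last x q)).2 ->
  leftward (curve pos (x :: q)) w \/ rightward (curve pos (x :: q)) w.
Proof.
move=> pq /(curve_cover pq)[c cc c2].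
by case: (leP w.1 c.1) => [|/ltW] h; [left | right]; exists c.
Qed.

(** At these heights the two closed sides of the path cover everything and meet only on the curve,
    so each is open and closed in a set [S] that avoids the curve. *)
Lemma connected_one_side x q S : path e x q -> connected S ->
  (forall w, S w -> (pos x).2 <= w.2 <= (pos (last x q)).2) ->
  (forall w, S w -> ~ curve pos (x :: q) w) ->
  (forall w, S w -> ~ leftward (curve pos (x :: q)) w) \/
  (forall w, S w -> ~ rightward (curve pos (x :: q)) w).
Proof.
move=> pq cS hS dS; set L := leftward _; set R := rightward _.
have [[w [Sw Lw]]|n] := pselect (exists w, S w /\ L w); last first.
  by left=> w Sw Lw; apply: n; exists w.
right=> v Sv Rv.
have cc := @curve_compact K T pos x q.
have SL : S `&` L = S.
  apply: cS; first by exists w.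
  - exists (~` R); first by rewrite openC; exact: closed_rightward.
    apply/seteqP; split=> z [Sz h]; split=> //.
      by move=> h'; apply: (dS _ Sz); exact: leftward_rightward.
    by case: (leftward_or_rightward pq (hS _ Sz)).
  - by exists L; first exact: closed_leftward.
have : (S `&` L) v by rewrite SL.
by case=> _ Lv; apply: (dS _ Sv); exact: leftward_rightward.
Qed.

Lemma curve_vertex_mem x q z : path e x q -> curve pos (x :: q) (pos z) -> z \in x :: q.
Proof.
move=> pq [[y yq /(pos_inj dr)->]//|[[a b] ab s]].
have /andP[aq bq] := steps_mem ab.
have := edge_vertex dr (steps_edge pq ab) s.
by case=> ->; rewrite ?aq// inE bq orbT.
Qed.

Lemma open_edge_vertex a b (r : K) z : e a b -> 0 < r < 1 ->
  pos a + r *: (pos b - pos a) <> pos z.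
Proof.
move=> eab /andP[r0 r1] h.
have ab : pos b - pos a != 0.
  by apply/eqP => /subr0_eq/(pos_inj dr) ba; rewrite ba (acyclic_irr acyc) in eab.
have s : segment (pos a) (pos b) (pos z) by exists r; rewrite ?h// !ltW.
have [za|zb] := edge_vertex dr eab s.
  move/eqP: h; rewrite za -subr_eq0 addrC addrA addNr add0r scaler_eq0 (negPf ab).
  by rewrite gt_eqF.
have : (1 - r) *: (pos b - pos a) == 0.
  by rewrite scalerBl scale1r subr_eq0 -(inj_eq (addrI (pos a))) h zb addrC subrK.
by rewrite scaler_eq0 (negPf ab) orbF subr_eq0 gt_eqF.
Qed.

Lemma curves_disjoint x q x' q' w : path e x q -> path e x' q' ->
  (forall z, z \in x :: q -> z \notin x' :: q') ->
  curve pos (x :: q) w -> ~ curve pos (x' :: q') w.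
Proof.
move=> pq pq' d c c'.
have hv z : w = pos z -> False.
  move=> wz; rewrite wz in c c'.
  by have := d _ (curve_vertex_mem pq c); rewrite (curve_vertex_mem pq' c').
case: c => [[z _ /hv]//|[[a b] ab s]].
case: c' => [[z _ /hv]//|[[a' b'] ab' s']].
have [/eqP h|/eqP h] := boolP ((a, b) == (a', b')).
  have /andP[h1 _] := steps_mem ab; have /andP[h2 _] := steps_mem ab'.
  by case: h h1 => -> _ /d; rewrite h2.
have := edge_edge dr (steps_edge pq ab) (steps_edge pq' ab') h s s'.
by case=> z [/hv].
Qed.

(** The part of the second curve at heights of the first is connected, by monotonicity, and misses
    the first, so it stays on one side. *)
Lemma paths_noncrossing x q x' q' : path e x q -> path e x' q' ->
  (forall z, z \in x :: q -> z \notin x' :: q') ->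
  (forall c c', curve pos (x :: q) c -> curve pos (x' :: q') c' -> c.2 = c'.2 ->
    c.1 < c'.1) \/
  (forall c c', curve pos (x :: q) c -> curve pos (x' :: q') c' -> c.2 = c'.2 ->
    c'.1 < c.1).
Proof.
move=> pq pq' d.
pose S := curve pos (x' :: q') `&`
  [set z | (pos x).2 <= z.2 <= (pos (last x q)).2].
have inS c c' : curve pos (x :: q) c -> curve pos (x' :: q') c' -> c.2 = c'.2 ->
    S c'.
  by move=> cc cc' h; split=> //=; rewrite -h; exact: (curve_height up pq cc).
have cS : connected S by apply: curve_slab_connected pq'; exact: up.
have dS w : S w -> ~ curve pos (x :: q) w.
  by case=> cw _ cw'; exact: (curves_disjoint pq pq' d cw').
have [|h|h] := connected_one_side pq cS _ dS; first by move=> w [].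
  left=> c c' cc cc' h2; rewrite ltNge; apply/negP => h1.
  by apply: h (inS _ _ cc cc' h2) _; exists c.
right=> c c' cc cc' h2; rewrite ltNge; apply/negP => h1.
by apply: h (inS _ _ cc cc' h2) _; exists c.
Qed.

(** Removing the end times leaves a connected set that can miss a path on which the curve begins and
    ends. *)
Definition open_arc x q : set (K * K) := polyline pos x q @` `]0, (size q)%:R[.

Lemma open_arc_connected x q : connected (open_arc x q).
Proof. by apply: polyline_connected; exact: interval_is_interval. Qed.

Lemma curve_open_arc x q w : curve pos (x :: q) w ->
  [\/ w = pos x, w = pos (last x q) | open_arc x q w].
Proof.
move=> /curve_polylineP[r /andP[r0 rs] ->].
move: r0; rewrite le_eqVlt => /orP[/eqP<-|r0].
  by apply: Or31; rewrite polyline_le0.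
move: rs; rewrite le_eqVlt => /orP[/eqP->|rs].
  by apply: Or32; rewrite polyline_ge.
by apply: Or33; exists r => //=; rewrite in_itv/= r0.
Qed.

Lemma open_arc_curve x q : open_arc x q `<=` curve pos (x :: q).
Proof. by move=> w [r _ <-]; rewrite curve_range; exists r. Qed.

Lemma open_arc_disjoint x q x' q' w : path e x q -> path e x' q' ->
  (forall z, z \in behead (belast x q) -> z \notin x' :: q') ->
  (forall ab, ab \in steps (x :: q) -> ab \notin steps (x' :: q')) ->
  open_arc x q w -> ~ curve pos (x' :: q') w.
Proof.
move=> pq pq' dv de [r]; rewrite /= in_itv/= => /polyline_interior rr <-.
case: (rr pos x) => [[z zq ->]|[[a b] /= ab [r' r01 ->]]].
  by move=> /(curve_vertex_mem pq'); apply/negP/dv.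
have eab := steps_edge pq ab.
have nv z : pos a + r' *: (pos b - pos a) <> pos z by exact: open_edge_vertex.
case=> [[z _ /nv]//|[[a' b'] ab' s']].
have h : (a, b) <> (a', b') by move=> h; have := de _ ab; rewrite h ab'.
have s : segment (pos a) (pos b) (pos a + r' *: (pos b - pos a)).
  by exists r' => //; case/andP: r01 => *; rewrite !ltW.
by have [z [/nv]] := edge_edge dr eab (steps_edge pq' ab') h s s'.
Qed.

End PlanarDrawing.

(** * Leftmost paths and the left boundary *)

Section Reachability.
Variables (T : finType) (e : rel T) (s t : T).
Hypothesis hst : st_digraph e s t.
Implicit Types (x y z : T).

Let acyc := st_acyclic hst.

(** A termination measure for following edges forward; acyclicity makes the inclusion strict at
    [x]. *)
Lemma connect_descend x y : e x y ->
  (#|[pred z | connect e y z]| < #|[pred z | connect e x z]|)%N.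
Proof.
move=> exy; apply/proper_card/properP; split.
  by apply/fintype.subsetP => z; rewrite !inE; exact: connect_trans (connect1 exy).
by exists x; rewrite inE ?connect0// (acyclic_edge acyc exy).
Qed.

Lemma connect_ascend x y : e x y ->
  (#|[pred z | connect e z x]| < #|[pred z | connect e z y]|)%N.
Proof.
move=> exy; apply/proper_card/properP; split.
  by apply/fintype.subsetP => z; rewrite !inE => /connect_trans; apply; exact: connect1.
by exists y; rewrite inE ?connect0// (acyclic_edge acyc exy).
Qed.

Lemma connect_sink x : connect e x t.
Proof.
have [k] := ubnP #|[pred z | connect e x z]|; elim: k x => // k IH x h.
have [[y exy]|n] := pselect (exists y, e x y).
  apply: connect_trans (connect1 exy) (IH _ _).
  exact: leq_trans (connect_descend exy) h.
rewrite (iffLR (st_sink hst x)) ?connect0// => y.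
by apply/negP => exy; apply: n; exists y.
Qed.

Lemma connect_source x : connect e s x.
Proof.
have [k] := ubnP #|[pred z | connect e z x]|; elim: k x => // k IH x h.
have [[y eyx]|n] := pselect (exists y, e y x).
  apply: connect_trans (IH _ _) (connect1 eyx).
  exact: leq_trans (connect_ascend eyx) h.
rewrite (iffLR (st_source hst x)) ?connect0// => y.
by apply/negP => eyx; apply: n; exists y.
Qed.

End Reachability.

Section LeftmostPath.
Variables (K : realType) (T : finType) (e : rel T) (s t : T) (pos : T -> K * K).
Hypothesis hst : st_digraph e s t.
Hypothesis dr : upward_planar_drawing e pos.
Implicit Types (x y z : T).

(* [a / (`|a| + b)] is a monotone substitute for the cosine of the direction [(a, b)]. *)
Lemma upward_directions (a b a' b' : K) : 0 <= b -> 0 <= b' ->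
  (a, b) != 0 -> (a', b') != 0 ->
  a / (`|a| + b) <= a' / (`|a'| + b') ->
  [\/ 0 < a' * b - b' * a, a' * b - b' * a = 0 /\ a < a'
    | exists2 c, 0 < c & a' = c * a /\ b' = c * b].
Proof.
move=> b0 b0' d d'.
have den (u v : K) : 0 <= v -> (u, v) != 0 -> 0 < `|u| + v :> K.
  move=> v0 uv; rewrite lt_def addr_ge0// andbT paddr_eq0// normr_eq0.
  by apply: contra uv => /andP[/eqP-> /eqP->].
have p := den _ _ b0 d; have p' := den _ _ b0' d'.
rewrite ler_pdivrMr// mulrAC ler_pdivlMr// => h.
have cr : 0 <= a' * b - b' * a.
  case: (ltP a 0) h => a0; case: (ltP a' 0) => a0'.
  - by rewrite (ltr0_norm a0) (ltr0_norm a0'); nra.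
  - by rewrite (ltr0_norm a0) (ger0_norm a0'); nra.
  - by rewrite (ltr0_norm a0'); move: p; rewrite (ger0_norm a0); nra.
  - by rewrite (ger0_norm a0) (ger0_norm a0'); nra.
move: cr; rewrite le_eqVlt => /orP[/eqP/esym cr|]; last by constructor 1.
case: (ltP a a') => aa; first by constructor 2.
(* The vectors are now parallel. The factor is read off the vertical coordinates, except for
   horizontal vectors, where the keys together with [aa] exclude opposite directions. *)
constructor 3; move: b0; rewrite le_eqVlt => /orP[/eqP bz|b0].
  rewrite -bz mulr0 sub0r in cr.
  have a0 : a != 0 by apply: contra d => /eqP->; rewrite -bz.
  have bz' : b' = 0.
    by move/eqP: cr; rewrite oppr_eq0 mulf_eq0 (negPf a0) orbF => /eqP.
  have a0' : a' != 0 by apply: contra d' => /eqP->; rewrite bz'.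
  exists (a' / a); last by rewrite -bz bz' mulr0 divfK.
  move: h; rewrite -bz bz' !addr0.
  case: (ltgtP a 0) a0 => // a0 _; case: (ltgtP a' 0) a0' => // a0' _ h.
  - by rewrite nmulr_rgt0// invr_lt0.
  - by have := lt_trans a0 a0'; rewrite ltNge aa.
  - by move: h; rewrite (gtr0_norm a0) (ltr0_norm a0'); nra.
  - by rewrite divr_gt0.
have b0n : b != 0 by rewrite gt_eqF.
have e1 : a' = b' / b * a.
  by rewrite mulrAC; apply/(mulIf b0n); rewrite divfK//; lra.
exists (b' / b); last by rewrite divfK.
rewrite divr_gt0// lt_def b0' andbT; apply: contra d' => /eqP b0z.
by rewrite e1 b0z !mul0r.
Qed.

(** The key [k] grows from the leftmost outgoing direction to the rightmost. Distinct edges cannot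
    have the same direction, since the shorter would end inside the longer. *)
Lemma left_of_total x y z : e x y -> e x z ->
  let k v := (pos v - pos x).1 / (`|(pos v - pos x).1| + (pos v - pos x).2) in
  k y <= k z -> z = y \/ left_of pos x y z.
Proof.
move=> exy exz /=.
have nz v : e x v -> ((pos v - pos x).1, (pos v - pos x).2) != 0.
  move=> exv; rewrite -surjective_pairing subr_eq0.
  by apply/eqP => /(pos_inj dr) vx; rewrite vx (acyclic_irr (st_acyclic hst)) in exv.
have ge v : e x v -> 0 <= (pos v - pos x).2.
  by move=> /(edge_upward dr); rewrite subr_ge0.
move=> /(upward_directions (ge _ exy) (ge _ exz) (nz _ exy) (nz _ exz)).
case=> [h|[h h']|[c c0 [h1 h2]]].
- by right; rewrite /left_of h.
- by right; rewrite /left_of h eqxx h' orbT.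
left.
have zd : pos z - pos x = c *: (pos y - pos x).
  by rewrite [LHS]surjective_pairing h1 h2.
have irr := acyclic_irr (st_acyclic hst).
have [c1|c1] := leP c 1.
  have [] := @edge_vertex _ _ _ _ dr x y z exy.
  - by exists c; rewrite ?c1 ?ltW// -zd addrC subrK.
  - by move=> zx; rewrite zx irr in exz.
  - by [].
have [] := @edge_vertex _ _ _ _ dr x z y exz.
- exists c^-1; first by rewrite invr_ge0 ltW//= invf_le1// ltW.
  by rewrite zd scalerA mulVf ?gt_eqF// scale1r addrC subrK.
- by move=> yx; rewrite yx irr in exy.
- by [].
Qed.

(** Greedy construction: among the outgoing edges from which [b] is still reachable, take one with
    the least key; the number of reachable vertices decreases. *)
Lemma leftmost_path_exists a b : connect e a b ->
  exists p, is_leftmost_path e pos a b p.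
Proof.
have [n] := ubnP #|[pred z | connect e a z]|; elim: n a => // n IH a h ab.
have [<-|ab'] := eqVneq a b.
  by exists [:: a]; split=> [|x y]; rewrite /= ?eqxx// /steps /= in_nil.
have [z0 hz0] : exists z, e a z && connect e z b.
  case/connectP: ab ab' => -[|z q] /=; first by move=> _ ->; rewrite eqxx.
  move=> /andP[eaz pq] lq _; exists z; rewrite eaz /=; apply/connectP.
  by exists q.
pose k v := (pos v - pos a).1 / (`|(pos v - pos a).1| + (pos v - pos a).2).
case: (@arg_minP _ _ _ z0 (fun z => e a z && connect e z b) k hz0).
move=> y /andP[eay yb] miny.
have [|[|y' q] [//= /and3P[/eqP yy pq lq] lm]] := IH y _ yb.
  exact: leq_trans (connect_descend hst eay) h.
subst y'; exists [:: a, y & q]; split; first by rewrite /= eqxx eay pq lq.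
move=> x w; rewrite steps_cons inE => /orP[/eqP[-> ->]|/lm//] z eaz zb.
by apply: left_of_total => //; apply: miny; rewrite eaz zb.
Qed.

Lemma leftmost_pathP a b : connect e a b ->
  is_path e a b (leftmost_path e pos a b).
Proof.
move=> /leftmost_path_exists[p hp].
by have := xgetPex [::] (ex_intro _ p hp); case.
Qed.

End LeftmostPath.

Section Steps.
Variables (T : finType) (e : rel T).
Implicit Types (x y z : T) (p q : seq T).

Lemma steps_cat x q q' :
  steps (x :: q ++ q') = steps (x :: q) ++ steps (last x q :: q').
Proof. by elim: q x => [|y q IH] x //=; rewrite !steps_cons IH. Qed.

Lemma steps_belast x q a b :
  (a, b) \in steps (x :: q) -> (a \in belast x q) && (b \in q).
Proof.
elim: q x => [|y q IH] x //.
rewrite steps_cons inE => /orP[/eqP[-> ->]|/IH /andP[h1 h2]].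
  by rewrite /= !mem_head.
by rewrite /= !inE h1 h2 !orbT.
Qed.

Lemma path_last_meet (A : pred T) z q : path e z q -> A z ->
  exists x a, [/\ A x, path e x a, last x a = last z q & all (predC A) a].
Proof.
elim/last_ind: q => [|q y IH]; first by exists z, [::].
rewrite rcons_path last_rcons => /andP[pq ey] Az.
have [Ay|nAy] := boolP (A y); first by exists y, [::].
have [x [a [Ax pa la Aa]]] := IH pq Az.
exists x, (rcons a y); split=> //; rewrite ?last_rcons ?rcons_path ?pa ?la//.
by rewrite all_rcons /= nAy.
Qed.

Lemma path_first_meet (A : pred T) y q : path e y q -> A (last y q) ->
  exists b, [/\ path e y b, A (last y b) & all (predC A) (belast y b)].
Proof.
elim: q y => [|z q IH] y; first by exists [::].
move=> /andP[eyz pq] Al.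
have [Ay|nAy] := boolP (A y); first by exists [::].
have [b [pb lb ab]] := IH z pq Al.
by exists (z :: b); split=> //=; rewrite ?eyz// nAy.
Qed.

End Steps.

Section LeftBoundary.
Variables (K : realType) (T : finType) (e : rel T) (s t : T) (pos : T -> K * K).
Hypothesis hst : st_digraph e s t.
Hypothesis dr : upward_planar_drawing e pos.
Implicit Types (x y z : T) (p q : seq T).

Let acyc := st_acyclic hst.
Let up := edge_upward dr.

Lemma connect_height x y : connect e x y -> (pos x).2 <= (pos y).2.
Proof.
case/connectP=> q pq ->.
have := curve_height up pq (curve_vertex pos (mem_head x q)).
by case/andP=> h; apply: le_trans.
Qed.

Lemma curve_height_st x q w : path e x q -> curve pos (x :: q) w ->
  (pos s).2 <= w.2 <= (pos t).2.
Proof.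
move=> pq /(curve_height up pq)/andP[h1 h2].
rewrite (le_trans _ h1) ?(le_trans h2)// connect_height//.
  exact: (connect_sink hst).
exact: (connect_source hst).
Qed.

Lemma curve_drawing x q : path e x q -> curve pos (x :: q) `<=` drawing e pos.
Proof.
move=> pq w [[z _ ->]|[[a b] ab sw]]; first by left; exists z.
by right; exists a, b; split=> //; exact: steps_edge ab.
Qed.

Lemma step_curve p x y : (x, y) \in steps p ->
  segment (pos x) (pos y) `<=` curve pos p.
Proof. by move=> xy w h; right; exists (x, y). Qed.

Lemma open_arc_nonempty x q : q != [::] -> exists w, open_arc pos x q w.
Proof.
case: q => // y q _; have s0 : 0 <= (size q)%:R :> K by rewrite ler0n.
have [h0 h1] : 0 < 2^-1 :> K /\ 2^-1 < (size q).+1%:R :> K.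
  by rewrite -[(size q).+1%:R]natr1; split; lra.
exists (polyline pos x (y :: q) 2^-1), 2^-1 => //.
by rewrite /= in_itv /=; apply/andP.
Qed.

(* If an edge passes strictly to the left of a point of an [s]-[t] path [q],
   follow it backward and forward until [q] is met, at [x0] and [y0]. The detour
   [E] thus obtained is strictly to the left of [q]; were the section [D] of [q]
   from [x0] to [y0] strictly to the left of the rerouted path, then points of
   [D] and [E] at the same height would be on both sides of each other. *)
Lemma reroute_left q x y w : path e s q -> last s q = t -> e x y ->
  segment (pos x) (pos y) w -> ~ rightward (curve pos (s :: q)) w ->
  exists q', [/\ path e s q', last s q' = t,
    rightward (curve pos (s :: q)) `<=` rightward (curve pos (s :: q')) &
    segment (pos x) (pos y) `<=` rightward (curve pos (s :: q'))].
Proof.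
move=> pq lq exy sw nw.
have uq := path_uniq acyc pq.
pose A := [pred z | z \in s :: q].
have Ain z : A z -> curve pos (s :: q) (pos z) by exact: curve_vertex.
have [x0 [a [Ax0 pa la nAa]]] : exists x0 a,
    [/\ A x0, path e x0 a, last x0 a = x & all (predC A) a].
  have /connectP[c pc ->] := connect_source hst x.
  by apply: path_last_meet pc _; rewrite /A inE mem_head.
have [b [pb Ay0 nAb]] : exists b,
    [/\ path e y b, A (last y b) & all (predC A) (belast y b)].
  have /connectP[c pc lc] := connect_sink hst y.
  by apply: path_first_meet pc _; rewrite -lc -lq /A inE mem_last.
move: Ay0; set y0 := last y b => Ay0.
pose E := a ++ y :: b.
have pE : path e x0 E by rewrite cat_path pa /= la exy.
have lE : last x0 E = y0 by rewrite last_cat.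
have nE : E != [::] by rewrite /E; case: (a).
have c0 : connect e x0 y0 by apply/connectP; exists E.
(* The detour leads from [x0] to [y0], so acyclicity places [y0] after [x0] on [q]. *)
have ne0 : ~ connect e y0 x0.
  case: (E) pE lE nE => // z E' /= /andP[e0z pE'] lE' _ c0'.
  have := acyclic_edge acyc e0z; rewrite (connect_trans _ c0')//.
  by apply/connectP; exists E'.
have [q1 [q2 [qE lq1]]] : exists q1 q2, q = q1 ++ q2 /\ last s q1 = x0.
  move: Ax0; rewrite /A inE; case/splitPl => q1 q2 h.
  by exists q1, q2.
have [pq1 pq2] : path e s q1 /\ path e x0 q2.
  by move: pq; rewrite qE cat_path lq1 => /andP.
have y0q2 : y0 \in q2.
  move: Ay0; rewrite /A inE qE -cat_cons mem_cat => /orP[|//] h.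
  by case: ne0; rewrite -lq1; apply: path_connect_last h.
have [r1 [r2 q2E]] : exists r1 r2, q2 = r1 ++ y0 :: r2.
  by case/splitPr: y0q2 => r1 r2; exists r1, r2.
pose D := rcons r1 y0.
have q2D : q2 = D ++ r2 by rewrite /D cat_rcons.
have lD : last x0 D = y0 by rewrite /D last_rcons.
have [pD pr2] : path e x0 D /\ path e y0 r2.
  by move: pq2; rewrite q2D cat_path lD => /andP.
have nD : D != [::] by rewrite /D; case: (r1).
have lr2 : last y0 r2 = t by rewrite -lq qE last_cat lq1 q2D last_cat lD.
have cq : curve pos (s :: q) = curve pos (s :: q1) `|`
    (curve pos (x0 :: D) `|` curve pos (y0 :: r2)).
  by rewrite qE curve_cat lq1 q2D curve_cat lD.
pose q' := q1 ++ E ++ r2.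
have cq' : curve pos (s :: q') = curve pos (s :: q1) `|`
    (curve pos (x0 :: E) `|` curve pos (y0 :: r2)).
  by rewrite curve_cat lq1 curve_cat lE.
have pq' : path e s q' by rewrite cat_path pq1 lq1 cat_path pE lE.
have lq' : last s q' = t by rewrite last_cat lq1 last_cat lE.
have Eleft c : open_arc pos x0 E c -> ~ rightward (curve pos (s :: q)) c.
  have [|||h|h] := @connected_one_side _ _ _ _ dr s q (open_arc pos x0 E) pq.
  - exact: open_arc_connected.
  - by move=> v /open_arc_curve/(curve_height_st pE); rewrite lq.
  - move=> v; apply: (open_arc_disjoint acyc dr pE pq).
      move=> z; rewrite /E belast_cat /= la -cat_rcons -la -lastI /= mem_cat.
      by move=> /orP[/(allP nAa)|/(allP nAb)].
    (* An edge of the detour other than that from [x] to [y] has an end off [q], and the latter is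
       no step of [q], since [w] would then lie on [q]. *)
    move=> [x' y']; rewrite /E steps_cat la steps_cons mem_cat inE.
    case/or3P => [/steps_belast/andP[_ /(allP nAa) h]|/eqP[-> ->]|].
    + apply/negP => /steps_mem/andP[_ /mem_behead h']; by rewrite /= h' in h.
    + apply/negP => h; apply: nw; apply: sub_rightward; exact: step_curve sw.
    + move=> /steps_belast/andP[/(allP nAb) h _].
      by apply/negP => /steps_mem/andP[h' _]; rewrite /= h' in h.
  - have wE : curve pos (x0 :: E) w.
      by apply: step_curve sw; rewrite /E steps_cat la steps_cons mem_cat mem_head orbT.
    case: (curve_open_arc wE) => wo.
    + by case: nw; apply: sub_rightward; rewrite wo; exact: Ain.
    + by case: nw; apply: sub_rightward; rewrite wo lE; exact: Ain.
    have [] // := leftward_or_rightward pq (_ : (pos s).2 <= w.2 <= (pos (last s q)).2).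
      by rewrite lq; exact: curve_height_st wE.
    by move=> /(h _ wo).
  - exact: h.
have Dq c : open_arc pos x0 D c -> curve pos (s :: q) c.
  by move=> /open_arc_curve h; rewrite cq; right; left.
have Eq c : open_arc pos x0 E c -> curve pos (s :: q') c.
  by move=> /open_arc_curve h; rewrite cq'; right; left.
have uD : uniq ((s :: q1) ++ D ++ r2) by rewrite cat_cons -q2D -qE.
have Ddisj c : open_arc pos x0 D c -> ~ curve pos (s :: q') c.
  move=> oc.
  have n1 : ~ curve pos (s :: q1) c.
    move: uD; rewrite cat_uniq => /and3P[_ /hasPn h _].
    apply: (open_arc_disjoint acyc dr pD pq1 _ _ oc).
      move=> z zD; apply: h; rewrite mem_cat; apply/orP; left.
      by move: zD; rewrite /D belast_rcons /= mem_rcons inE orbC => ->.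
    move=> [x' y'] /steps_belast/andP[_ yD]; apply/negP => /steps_belast/andP[_ y1].
    have := h y'; rewrite mem_cat yD => /(_ isT)/negP; apply.
    by rewrite inE y1 orbT.
  have n2 : ~ curve pos (y0 :: r2) c.
    have u2 : uniq (x0 :: r1 ++ y0 :: r2).
      by rewrite -q2E; exact: (path_uniq acyc pq2).
    move: u2; rewrite -cat_cons cat_uniq => /and3P[_ /hasPn h _].
    apply: (open_arc_disjoint acyc dr pD pr2 _ _ oc).
      move=> z; rewrite /D belast_rcons /= => zr; apply/negP => /h/negP; apply.
      by rewrite inE zr orbT.
    move=> [x' y'] /steps_belast/andP[xD _]; apply/negP => /steps_mem/andP[/h/negP x2 _].
    by apply: x2; rewrite /D belast_rcons in xD.
  rewrite cq' => -[//|[|//]] /curve_open_arc[] h.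
  - by apply: n1; rewrite h -lq1; apply: curve_vertex; exact: mem_last.
  - by apply: n2; rewrite h lE; apply: curve_vertex; exact: mem_head.
  - by apply: Eleft h _; apply: sub_rightward; exact: Dq.
have [|||Dr|Dl] := @connected_one_side _ _ _ _ dr s q' (open_arc pos x0 D) pq'.
- exact: open_arc_connected.
- by move=> v /open_arc_curve/(curve_height_st pD); rewrite lq'.
- exact: Ddisj.
(* Here [D] is to the right of the rerouted path, so whatever is to the right of [D] is to the right
   of that path as well. *)
- exists q'; split=> //.
    move=> z [d dq [d2 d1]].
    have [dq'|nd] := pselect (curve pos (s :: q') d); first by exists d.
    have oD : open_arc pos x0 D d.
      move: dq nd; rewrite cq cq' => -[h nd|[h nd|h nd]].
      - by case: nd; left.
      - case: (curve_open_arc h) => // hd; case: nd.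
          by left; rewrite hd -lq1; apply: curve_vertex; exact: mem_last.
        by right; right; rewrite hd lD; apply: curve_vertex; exact: mem_head.
      - by case: nd; right; right.
    have [|h|[c cq1 [c2 c1]]] :=
        leftward_or_rightward pq' (_ : (pos s).2 <= d.2 <= (pos (last s q')).2).
    + by rewrite lq'; exact: curve_height_st pq dq.
    + by case: (Dr _ oD).
    + by exists c => //; rewrite c2 d2; split=> //; exact: le_trans d1.
  move=> v hv; apply: sub_rightward; rewrite cq'; right; left.
  by apply: step_curve hv; rewrite /E steps_cat la steps_cons mem_cat mem_head orbT.
exfalso.
(* At the mean height of [x0] and [y0] no end point interferes; if these two are level, all of [D]
   and [E] is at their height. *)
have [c [d [oc od cd]]] : exists c d,
    [/\ open_arc pos x0 E c, open_arc pos x0 D d & c.2 = d.2].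
  have := connect_height c0; rewrite le_eqVlt => /orP[/eqP h|h].
    have [c oc] := open_arc_nonempty x0 nE; have [d od] := open_arc_nonempty x0 nD.
    exists c, d; split=> //.
    have /(curve_height up pE) := open_arc_curve oc.
    have /(curve_height up pD) := open_arc_curve od.
    by rewrite lE lD -h -!eq_le => /eqP<- /eqP<-.
  pose m := ((pos x0).2 + (pos y0).2) / 2.
  have [|c cE cm] := @curve_cover _ _ pos e x0 E m pE; first by rewrite lE /m; lra.
  have [|d dD dm] := @curve_cover _ _ pos e x0 D m pD; first by rewrite lD /m; lra.
  exists c, d; split; last by rewrite cm dm.
    by case: (curve_open_arc cE) => // hc; move: cm; rewrite hc ?lE /m; lra.
  by case: (curve_open_arc dD) => // hd; move: dm; rewrite hd ?lD /m; lra.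
case: (leP c.1 d.1) => h.
  by apply: Dl od _; exists c; [exact: Eq | split].
by apply: Eleft oc _; exists d; [exact: Dq | split=> //; exact: ltW].
Qed.

End LeftBoundary.

Section LeftBoundaryExists.
Variables (K : realType) (T : finType) (e : rel T) (s t : T) (pos : T -> K * K).
Hypothesis hst : st_digraph e s t.
Hypothesis dr : upward_planar_drawing e pos.
Implicit Types (x y z : T) (p q : seq T).

Let acyc := st_acyclic hst.
Let up := edge_upward dr.

Lemma drawing_edge w : drawing e pos w ->
  w = pos s \/ exists x y, e x y /\ segment (pos x) (pos y) w.
Proof.
case=> [[x _ <-]|[x [y h]]]; last by right; exists x, y.
have [[y eyx]|n] := pselect (exists y, e y x).
  by right; exists y, x; split=> //; exact: segment_end.
left; congr pos; apply/(st_source hst) => y.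
by apply/negP => eyx; apply: n; exists y.
Qed.

(** Take any path from [s] to [t] and reroute it while part of the drawing is not to its right. Each
    time [N q], the set of edges wholly to the right of the path, gains an edge, so this stops. *)
Lemma left_boundary_exists : exists p, is_left_boundary e pos s t p.
Proof.
pose N q := [pred xy : T * T | e xy.1 xy.2 &&
  `[< segment (pos xy.1) (pos xy.2) `<=` rightward (curve pos (s :: q)) >]].
suff H k q : path e s q -> last s q = t -> (#|{: T * T}| - #|N q| < k)%N ->
    exists p, is_left_boundary e pos s t p.
  by have /connectP[q pq /esym lq] := connect_sink hst s; exact: H pq lq (ltnSn _).
elim: k q => // k IH q pq lq hk.
have [h|/existsNP[w /not_implyP[dw nw]]] :=
    pselect (forall w, drawing e pos w -> rightward (curve pos (s :: q)) w).
  by exists (s :: q); split=> //=; rewrite eqxx pq lq eqxx.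
case: (drawing_edge dw) => [ws|[x [y [exy sw]]]].
  by case: nw; rewrite ws; apply: sub_rightward; apply: curve_vertex; exact: mem_head.
have [q' [pq' lq' sub sxy]] := reroute_left hst dr pq lq exy sw nw.
apply: (IH q') => //.
have NN : (#|N q| < #|N q'|)%N.
  apply/proper_card/properP; split.
    apply/fintype.subsetP => -[a b]; rewrite !inE /= => /andP[-> /asboolP h] /=.
    by apply/asboolP; exact: subset_trans h sub.
  exists (x, y); rewrite !inE /= exy /=; first exact/asboolP.
  by apply/asboolP => /(_ _ sw).
apply: (leq_trans (ltn_sub2l _ NN)) => //.
exact: leq_trans NN (max_card _).
Qed.

Lemma left_boundaryP : is_left_boundary e pos s t (left_boundary e pos s t).
Proof.
have [p hp] := left_boundary_exists.
exact: (xgetPex [::] (ex_intro _ p hp)).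
Qed.

(** Both edges would extend horizontally to the left of [w], and the one of [x] and [y] nearer to
    [w] would lie on the edge of the other. *)
Lemma nonoverlapping_turn x w y : e x w -> e w y ->
  (pos x).2 = (pos w).2 -> (pos y).2 = (pos w).2 ->
  (pos x).1 <= (pos w).1 -> (pos y).1 <= (pos w).1 -> False.
Proof.
move=> exw ewy hx hy.
have on (a b c : K * K) : a.2 = c.2 -> b.2 = c.2 -> a.1 <= b.1 -> b.1 <= c.1 ->
    segment a c b.
  case: a b c => [a a'] [b b'] [c c'] /= -> ->.
  have [->|ac] := eqVneq a c => ab bc.
    have -> : b = c by apply/le_anti; rewrite bc ab.
    exact: segment_end.
  have ac0 : 0 < c - a by rewrite subr_gt0 lt_neqAle ac (le_trans ab bc).
  exists ((b - a) / (c - a)); last first.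
    rewrite [LHS]surjective_pairing [RHS]surjective_pairing /=; congr (_, _).
      by rewrite -[_ *: _]/(_ * _) divfK ?gt_eqF//; lra.
    by rewrite -[_ *: _]/(_ * _); ring.
  by rewrite ler_pdivrMr// ler_pdivlMr//; lra.
move=> xw yw; case: (leP (pos x).1 (pos y).1) => xy.
  have [] := @edge_vertex _ _ _ _ dr x w y exw.
  - by apply: on; rewrite // ?hx.
  - by move=> yx; rewrite yx in ewy; have := acyclic_edge acyc exw; rewrite connect1.
  - by move=> yw'; rewrite yw' (acyclic_irr acyc) in ewy.
have [] := @edge_vertex _ _ _ _ dr w y x ewy.
- by apply: segmentC; apply: on => //; exact: ltW.
- by move=> xw'; rewrite xw' (acyclic_irr acyc) in exw.
- by move=> yx; rewrite yx in exw; have := acyclic_edge acyc exw; rewrite connect1.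
Qed.

End LeftBoundaryExists.

Lemma closed_segment_end (K : realType) (F : set (K * K)) (a c : K * K) :
  closed F -> (forall r, 0 < r < 1 -> F (a + r *: (c - a))) -> F c.
Proof.
move=> cF h; apply: contrapT => nF.
pose g r := a + r *: (c - a).
have cg : {for 1, continuous g}.
  apply: cvgD; first exact: cvg_cst.
  by apply: cvgZr_tmp; exact: cvg_id.
have g1 : g 1 = c by rewrite /g scale1r addrC subrK.
have : nbhs (g 1) (~` F) by rewrite g1; apply: open_nbhs_nbhs; split; rewrite ?openC.
move=> /cg /nbhs_ballP[eps /= eps0 sub].
(* Half the minimum keeps [1 - m] within [eps] of 1 and strictly between 0 and 1. *)
pose m : K := Num.min eps 1 / 2.
have me : 0 < Num.min eps 1 by rewrite lt_min eps0 ltr01.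
have m1 : Num.min eps 1 <= 1 by rewrite ge_min lexx orbT.
have m2 : Num.min eps 1 <= eps by rewrite ge_min lexx.
apply: (sub (1 - m)); last by apply: h; rewrite /m; lra.
by rewrite /ball /= opprB addrC subrK ger0_norm /m; lra.
Qed.

Section LeftBoundaryLeft.
Variables (K : realType) (T : finType) (e : rel T) (s t : T) (pos : T -> K * K).
Hypothesis hst : st_digraph e s t.
Hypothesis dr : upward_planar_drawing e pos.
Implicit Types (x y z : T) (p q : seq T).

Let acyc := st_acyclic hst.
Let up := edge_upward dr.

(* At a height strictly between those of its ends, a step of the left boundary is
   the only part of the boundary, so that all of the drawing is to its right. *)
Lemma boundary_step_leftward b q a c : is_left_boundary e pos s t (s :: b) ->
  path e s q -> last s q = t -> (a, c) \in steps (s :: b) ->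
  (pos a).2 < (pos c).2 ->
  leftward (curve pos (s :: q)) (pos a) /\ leftward (curve pos (s :: q)) (pos c).
Proof.
move=> [/and3P[_ pb _] bB] pq lq ac hac.
have [b1 [b2 [bE la]]] : exists b1 b2, b = b1 ++ c :: b2 /\ last s b1 = a.
  elim: (b) (s) ac {bB pb} => [|y b' IH] x //.
  rewrite steps_cons inE => /orP[/eqP[-> ->]|/IH[b1 [b2 [-> <-]]]].
    by exists [::], b'.
  by exists (y :: b1), b2.
move: pb; rewrite bE cat_path la /= => /and3P[pb1 eac pb2].
have mid r : 0 < r < 1 -> leftward (curve pos (s :: q)) (pos a + r *: (pos c - pos a)).
  move=> /andP[r0 r1]; set m := _ + _.
  have m2 : m.2 = (pos a).2 + r * ((pos c).2 - (pos a).2) by [].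
  have [h1 h2] : (pos a).2 < m.2 /\ m.2 < (pos c).2 by rewrite m2; split; nra.
  have cm : curve pos [:: a; c] m.
    by rewrite curve_cons; left; exists r; rewrite ?ltW.
  have [|d dq d2] := @curve_cover _ _ pos e s q m.2 pq.
    rewrite lq; apply: (curve_height_st hst dr (_ : path e a [:: c]) cm).
    by rewrite /= eac.
  have [b' b'B [b'2 b'1]] := bB d (curve_drawing pq dq).
  suff bm : b' = m by exists d; rewrite // -bm b'1 b'2.
  move: b'B; rewrite bE curve_cat la curve_cons => -[|[|]].
  - by move=> /(curve_height up pb1)/andP[_]; rewrite la b'2 d2 leNgt h1.
  - case=> r' _ b'E; rewrite b'E /m; congr (_ + _ *: _).
    have : b'.2 = m.2 by rewrite b'2.
    rewrite b'E m2 -[(_ + _).2]/((pos a).2 + r' * ((pos c).2 - (pos a).2)).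
    by move=> /addrI/mulIf; apply; rewrite subr_eq0 gt_eqF.
  - by move=> /(curve_height up pb2)/andP[]; rewrite b'2 d2 leNgt h2.
have cl := closed_leftward (@curve_compact _ _ pos s q).
split; last exact: closed_segment_end cl mid.
apply: (closed_segment_end (a := pos c) cl) => r r01.
have -> : pos c + r *: (pos a - pos c) = pos a + (1 - r) *: (pos c - pos a).
  by rewrite scalerBl scale1r !scalerBr; ring.
by apply: mid; lra.
Qed.

(* At the rightmost boundary vertex of a given height, boundary steps that are
   both horizontal would overlap. *)
Lemma boundary_vertex_leftward b q w : is_left_boundary e pos s t (s :: b) ->
  path e s q -> last s q = t -> w \in s :: b ->
  leftward (curve pos (s :: q)) (pos w).
Proof.
move=> bB pq lq wb; apply: contrapT => nw.
have [/and3P[_ pb /eqP lb] _] := bB.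
pose P z := (z \in s :: b) && ((pos z).2 == (pos w).2).
have Pw : P w by rewrite /P wb eqxx.
case: (@arg_maxP _ _ _ w P (fun z => (pos z).1) Pw) => m /andP[mb /eqP m2] maxm.
have nm : ~ leftward (curve pos (s :: q)) (pos m).
  move=> [c cq [c2 c1]]; apply: nw; exists c => //; split; first by rewrite c2.
  exact: le_trans (maxm _ Pw) c1.
have nvm z : z \in s :: q -> m != z.
  move=> zq; apply/eqP => mz; apply: nm; apply: sub_leftward.
  by apply: curve_vertex; rewrite mz.
(* A rising step at [m] would put [m] to the left of [q], so the boundary steps at [m] are
   horizontal. There is one into [m] and one out of it, because [q] contains [s] and [t], so that
   [m] is neither. *)
have stepm a c : (a, c) \in steps (s :: b) -> m = a \/ m = c -> (pos a).2 = (pos c).2.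
  move=> ac mac; apply/le_anti; rewrite (up (steps_edge pb ac)) /= leNgt.
  apply/negP => /(boundary_step_leftward bB pq lq ac)[h1 h2].
  by apply: nm; case: mac => ->.
have mb' : m \in b by move: mb; rewrite inE (negPf (nvm _ (mem_head _ _))).
have mt : m != t by rewrite -lq; apply: nvm; exact: mem_last.
have [b1 [b2 bE]] : exists b1 b2, b = b1 ++ m :: b2.
  by case/splitPr: mb' => b1 b2; exists b1, b2.
case: b2 => [|y b2] in bE *.
  by rewrite -lb bE last_cat eqxx in mt.
move: pb; rewrite bE cat_path /= => /and4P[_ exm emy _].
have s1 : (last s b1, m) \in steps (s :: b).
  by rewrite bE steps_cat steps_cons mem_cat mem_head orbT.
have s2 : (m, y) \in steps (s :: b).
  by rewrite bE steps_cat !steps_cons mem_cat !inE eqxx !orbT.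
have h1 := stepm _ _ s1 (or_intror erefl).
have h2 := stepm _ _ s2 (or_introl erefl).
apply: (nonoverlapping_turn hst dr exm emy h1 (esym h2)); apply: maxm.
  by rewrite /P h1 m2 eqxx andbT bE -cat_cons mem_cat mem_last.
by rewrite /P -h2 m2 eqxx andbT bE -cat_cons mem_cat !inE eqxx !orbT.
Qed.

End LeftBoundaryLeft.

Lemma bounded_setP (K : realType) (X : set (K * K)) :
  bounded_set X <-> exists M : K, forall z, X z -> `|z.1| <= M /\ `|z.2| <= M.
Proof.
split=> [/pinfty_ex_gt0[M _ h]|[M h]].
  by exists M => z /h; rewrite /= prod_normE ge_max => /andP.
exists M; split; first exact: num_real.
move=> M' /ltW MM' z /h[h1 h2].
by rewrite /= prod_normE ge_max (le_trans h1)// (le_trans h2).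
Qed.

(** * The left side of a path *)

Section EnclosedRegion.
Variables (K : realType) (T : finType) (e : rel T) (s t : T) (pos : T -> K * K).
Hypothesis hst : st_digraph e s t.
Hypothesis dr : upward_planar_drawing e pos.
Implicit Types (x y z : T) (p q b : seq T).

Let acyc := st_acyclic hst.
Let up := edge_upward dr.

(** The horizontal ray from [w] to the right avoids [C], is connected and is unbounded. *)
Lemma ray_outer_face (C : set (K * K)) (w : K * K) :
  (forall z : K * K, C z -> z.2 = w.2 -> z.1 < w.1) -> outer_face C w.
Proof.
move=> hC; pose g (r : K) : K * K := (w.1 + r, w.2).
pose R := g @` `[0, +oo[.
have RC : R `<=` ~` C.
  move=> z [r /=]; rewrite in_itv/= andbT => r0 <- /hC /(_ erefl) /=.
  by rewrite ltNge lerDl r0.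
have Rw : R w.
  by exists 0; rewrite /= ?in_itv/= ?lexx// /g addr0 -surjective_pairing.
have cR : connected R.
  apply: connected_continuous_connected.
    by apply/connected_intervalP; exact: interval_is_interval.
  apply: continuous_subspaceT => r.
  apply: (@cvg_pair _ _ _ _ (nbhs (w.1 + r)) (nbhs w.2)); last exact: cvg_cst.
  by apply: cvgD; [exact: cvg_cst | exact: cvg_id].
split; first exact: RC.
move=> /bounded_setP[M hM].
(* The parameter is chosen to give an abscissa greater than [M]. *)
have [|] := hM (g (`|M| + `|w.1| + 1)).
  apply: (connected_component_max Rw RC cR).
  by exists (`|M| + `|w.1| + 1) => //=; rewrite in_itv/= andbT !addr_ge0.
have h1 : - `|w.1| <= w.1 by rewrite lerNl -normrN ler_norm.
have h2 := ler_norm M; have h3 := normr_ge0 w.1.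
by move=> /(le_trans (ler_norm _)) /=; lra.
Qed.

(* Off the two curves, the region [E] between them is closed and coincides with
   the open set [O], so it contains the component of each of its points. *)
Lemma between_enclosed b q (w : K * K) : path e s b -> last s b = t ->
  path e s q -> last s q = t ->
  leftward (curve pos (s :: q)) w -> rightward (curve pos (s :: b)) w ->
  enclosed_region (curve pos (s :: q) `|` curve pos (s :: b)) w.
Proof.
move=> pb lb pq lq wq wb [nw]; apply.
set C := _ `|` _ in nw *.
pose Q := curve pos (s :: q); pose B := curve pos (s :: b).
have cQ : compact Q by exact: curve_compact.
have cB : compact B by exact: curve_compact.
pose E := leftward Q `&` rightward B.
pose O := [set z : K * K | (pos s).2 < z.2 < (pos t).2] `&`
  ~` rightward Q `&` ~` leftward B.
have cE : closed E by apply: closedI; [exact: closed_leftward | exact: closed_rightward].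
have oO : open O.
  apply: openI; last by rewrite openC; exact: closed_leftward.
  apply: openI; last by rewrite openC; exact: closed_rightward.
  have -> : [set z : K * K | (pos s).2 < z.2 < (pos t).2] =
      snd @^-1` `](pos s).2, (pos t).2[%classic.
    by apply/seteqP; split=> z /=; rewrite in_itv.
  by apply: open_comp; [move=> z _; exact: cvg_snd | exact: itv_open].
have [sQ tQ] : Q (pos s) /\ Q (pos t).
  by split; apply: curve_vertex; rewrite ?mem_head// -lq mem_last.
have [sB tB] : B (pos s) /\ B (pos t).
  by split; apply: curve_vertex; rewrite ?mem_head// -lb mem_last.
have EO (z : K * K) : ~ C z -> E z <-> O z.
  move=> nC; have nQ : ~ Q z by move=> h; apply: nC; left.
  have nB : ~ B z by move=> h; apply: nC; right.
  split=> [[zq zb]|[[/= /andP[h1 h2] zq] zb]]; last first.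
    have h : (pos s).2 <= z.2 <= (pos t).2 by rewrite !ltW.
    split.
      by have [|//|//] := @leftward_or_rightward _ _ _ pos s q z pq; rewrite lq.
    by have [|//|//] := @leftward_or_rightward _ _ _ pos s b z pb; rewrite lb.
  (* A point of [E] level with [s] or [t], which lie on both curves, would be on one of the curves;
     hence the strict inequalities in [O]. *)
  have nend x : Q (pos x) -> B (pos x) -> (pos x).2 <> z.2.
    move=> xQ xB hx; case: (leP z.1 (pos x).1) => zx.
      by apply: nB; apply: (leftward_rightward dr pb) => //; exists (pos x).
    apply: nQ; apply: (leftward_rightward dr pq) => //.
    by exists (pos x) => //; split=> //; exact: ltW.
  split; last by move=> h; apply: nB; exact: (leftward_rightward dr pb).
  split; last by move=> h; apply: nQ; exact: (leftward_rightward dr pq).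
  case: zq => c cq [c2 _]; have := curve_height_st hst dr pq cq.
  rewrite c2 => /andP[h1 h2] /=; rewrite !lt_neqAle h1 h2 !andbT.
  by apply/andP; split; apply/eqP; [exact: nend | move=> /esym; exact: nend].
pose G := connected_component (~` C) w.
have GC : G `<=` ~` C by exact: connected_component_sub.
have GE : G `&` E = G.
  apply: (@component_connected _ (~` C) w).
  - exists w; split; first exact: connected_component_refl.
    by split.
  - exists O => //; apply/seteqP; split=> z [Gz h]; split=> //.
      exact: (iffLR (EO _ (GC _ Gz))).
    exact: (iffRL (EO _ (GC _ Gz))).
  - by exists E.
have [M1 hM1] := iffLR (bounded_setP _) (compact_bounded cQ).
have [M2 hM2] := iffLR (bounded_setP _) (compact_bounded cB).
apply/bounded_setP; exists (Num.max M1 M2) => z.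
rewrite -[connected_component _ _]/G -GE.
move=> -[_ [[c /hM1 + [c2 c1]] [d /hM2 + [d2 d1]]]].
move=> [/ler_normlP[_ h1] h2] [/ler_normlP[h3 _] h4].
split; last by rewrite -c2 le_max h2.
apply/ler_normlP; rewrite !le_max; split; apply/orP; [right | left]; lra.
Qed.

(** If [w] is not to the left of [q], the ray from [w] to the right misses [q]. Were it to meet the
    boundary, [w] would be on both sides of the boundary, hence one of its vertices, and these are
    all to the left of [q]. *)
Lemma enclosed_vertexP b q w : is_left_boundary e pos s t (s :: b) ->
  path e s q -> last s q = t ->
  enclosed_region (curve pos (s :: q) `|` curve pos (s :: b)) (pos w) <->
  leftward (curve pos (s :: q)) (pos w).
Proof.
move=> bB pq lq; have [/and3P[_ pb /eqP lb] dB] := bB.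
have wr : rightward (curve pos (s :: b)) (pos w).
  by apply: dB; left; exists w.
split=> h; last exact: between_enclosed.
apply: contrapT => nl; apply: h; apply: ray_outer_face => z zC z2.
rewrite ltNge; apply/negP => z1; apply: nl; case: zC => zC; first by exists z.
apply: (boundary_vertex_leftward hst dr bB pq lq).
apply: (curve_vertex_mem dr pb); apply: (leftward_rightward dr pb) => //.
by exists z.
Qed.

Lemma left_sideP a (b : T) p w : is_path e a b p ->
  left_side e pos s t a b p (pos w) <->
  leftward (curve pos (leftmost_path e pos s a) `|` curve pos p
    `|` curve pos (leftmost_path e pos b t)) (pos w).
Proof.
case: p => // a' p /and3P[/eqP-> pp /eqP lp]; rewrite /left_side.
have := leftmost_pathP hst dr (connect_source hst a).
case: (leftmost_path e pos s a) => // s' q1 /and3P[/eqP-> pq1 /eqP lq1].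
have := leftmost_pathP hst dr (connect_sink hst b).
case: (leftmost_path e pos b t) => // b' q2 /and3P[/eqP-> pq2 /eqP lq2].
have := left_boundaryP hst dr.
case: (left_boundary e pos s t) => [[]//|s'' B] hB.
have sE : s'' = s by case: hB => /and3P[/eqP].
subst s''.
have -> : curve pos (s :: q1) `|` curve pos (a :: p) `|` curve pos (b :: q2) =
    curve pos (s :: q1 ++ p ++ q2).
  by rewrite curve_cat lq1 curve_cat lp setUA.
apply: enclosed_vertexP => //.
  by rewrite cat_path pq1 lq1 cat_path pp lp.
by rewrite last_cat lq1 last_cat lp.
Qed.

End EnclosedRegion.

(** * Parity of relative positions *)

Section WeaklyLeft.
Variables (K : realType) (T : finType) (e : rel T) (s t : T) (pos : T -> K * K).
Hypothesis hst : st_digraph e s t.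
Hypothesis dr : upward_planar_drawing e pos.
Implicit Types (w x y z : T) (p q : seq T).

Let acyc := st_acyclic hst.
Let up := edge_upward dr.

Definition weakly_left w p : bool := `[< leftward (curve pos p) (pos w) >].

Lemma leftwardU (A B : set (K * K)) : leftward (A `|` B) = leftward A `|` leftward B.
Proof.
apply/seteqP; split=> z; first by case=> c [] cAB h; [left | right]; exists c.
by case=> -[c cAB h]; exists c => //; [left | right].
Qed.

(** Inclusion and exclusion modulo 2. If [w] is to the left of both parts, it is level with the
    common vertex; were it strictly to the right of that vertex, it would lie on both parts, which
    acyclicity allows only for the common vertex itself. *)
Lemma weakly_left_cat w a q q' : path e a q -> path e (last a q) q' ->
  weakly_left w (a :: q ++ q') =
  weakly_left w (a :: q) (+) weakly_left w (last a q :: q')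
    (+) weakly_left w [:: last a q].
Proof.
set x := last a q => pq pq'.
have h12 : weakly_left w (a :: q) -> weakly_left w (x :: q') -> weakly_left w [:: x].
  move=> /asboolP[c cc [c2 c1]] /asboolP[d dd [d2 d1]].
  have := curve_height up pq cc; rewrite -/x => /andP[_ cx].
  have /andP[dx _] := curve_height up pq' dd.
  have wx : (pos x).2 = (pos w).2 by apply/le_anti; rewrite -{1}d2 dx -c2 cx.
  apply/asboolP; exists (pos x); first by apply: curve_vertex; exact: mem_head.
  split=> //; rewrite leNgt; apply/negP => xw.
  have w1 : w \in a :: q.
    apply: (curve_vertex_mem dr pq); apply: (curve_slice up pq _ cc wx) => //.
      by apply: curve_vertex; exact: mem_last.
    by rewrite (ltW xw) c1.
  have w2 : w \in x :: q'.
    apply: (curve_vertex_mem dr pq'); apply: (curve_slice up pq' _ dd wx) => //.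
      by apply: curve_vertex; exact: mem_head.
    by rewrite (ltW xw) d1.
  have wE := acyclic_anti acyc (path_connect_last pq w1) (path_connect pq' w2).
  by rewrite wE ltxx in xw.
have h01 : weakly_left w [:: x] -> weakly_left w (a :: q).
  move=> /asboolP[c]; rewrite curve1 => -> h; apply/asboolP; exists (pos x) => //.
  by apply: curve_vertex; exact: mem_last.
have h02 : weakly_left w [:: x] -> weakly_left w (x :: q').
  move=> /asboolP[c]; rewrite curve1 => -> h; apply/asboolP; exists (pos x) => //.
  by apply: curve_vertex; exact: mem_head.
have -> : weakly_left w (a :: q ++ q') =
    weakly_left w (a :: q) || weakly_left w (x :: q').
  by rewrite /weakly_left curve_cat leftwardU asbool_or.
by move: h12 h01 h02; do 3 case: (weakly_left _ _) => //=; move=> h1 h2 h3;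
  rewrite ?(h1 isT isT) // ?(h2 isT) // ?(h3 isT).
Qed.

Lemma left_side_addb a (b : T) p w : is_path e a b p ->
  `[< left_side e pos s t a b p (pos w) >] =
  (weakly_left w (leftmost_path e pos s a) (+) weakly_left w [:: a])
  (+) (weakly_left w (leftmost_path e pos b t) (+) weakly_left w [:: b])
  (+) weakly_left w p.
Proof.
move=> ab; rewrite (asbool_equiv_eq (left_sideP hst dr w ab)).
case: p ab => // a' p /and3P[/eqP-> pp /eqP lp].
have := leftmost_pathP hst dr (connect_source hst a).
case: (leftmost_path e pos s a) => // s' q1 /and3P[/eqP-> pq1 /eqP lq1].
have := leftmost_pathP hst dr (connect_sink hst b).
case: (leftmost_path e pos b t) => // b' q2 /and3P[/eqP-> pq2 /eqP lq2].
have := @weakly_left_cat w s q1 (p ++ q2) pq1; rewrite lq1 cat_path pp lp /=.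
move=> /(_ pq2); have := @weakly_left_cat w a p q2 pp; rewrite lp => /(_ pq2) ->.
rewrite {1}/weakly_left curve_cat lq1 curve_cat lp setUA => ->.
by do 5 case: (weakly_left _ _).
Qed.

Definition below (x y : T) : bool := (pos x).2 < (pos y).2.

(* The opposite tie-breaking rules of [start_lt] and [end_lt] are what
   [disjoint_paths_parity] requires when end points have equal height. *)
Definition start_lt (x y : T) : bool :=
  ((pos x).2 < (pos y).2) || ((pos x).2 == (pos y).2) && ((pos y).1 < (pos x).1).

Definition end_lt (x y : T) : bool :=
  ((pos x).2 < (pos y).2) || ((pos x).2 == (pos y).2) && ((pos x).1 < (pos y).1).

Lemma start_ltC x y : x != y -> start_lt y x = ~~ start_lt x y.
Proof.
move=> xy; rewrite /start_lt.
have : pos x != pos y by rewrite (inj_eq (pos_inj dr)).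
rewrite [pos x]surjective_pairing [pos y]surjective_pairing xpair_eqE /=.
by case: (ltgtP (pos x).2 (pos y).2) => //=; case: ltgtP; rewrite ?andbF.
Qed.

Lemma end_ltC x y : x != y -> end_lt y x = ~~ end_lt x y.
Proof.
move=> xy; rewrite /end_lt.
have : pos x != pos y by rewrite (inj_eq (pos_inj dr)).
rewrite [pos x]surjective_pairing [pos y]surjective_pairing xpair_eqE /=.
by case: (ltgtP (pos x).2 (pos y).2) => //=; case: ltgtP; rewrite ?andbF.
Qed.

Lemma end_lt_trans : transitive end_lt.
Proof.
move=> y x z; rewrite /end_lt => /orP[xy|/andP[/eqP-> xy]] /orP[yz|/andP[/eqP yz yz']].
- by rewrite (lt_trans xy yz).
- by rewrite -yz xy.
- by rewrite yz.
- by rewrite yz eqxx (lt_trans xy yz') orbT.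
Qed.

(** Exchanging the paths negates both [start_lt] and [end_lt], so the first path may be taken to be
    on the left. Then the ends of the second are never to the left of the first, and an end of the
    first is to the left of the second exactly when the second reaches its height. *)
Lemma disjoint_paths_parity u q u' q' : path e u q -> path e u' q' ->
  (forall z, z \in u :: q -> z \notin u' :: q') ->
  let v := last u q in let v' := last u' q' in
  weakly_left u' (u :: q) (+) weakly_left v' (u :: q)
    (+) (weakly_left u (u' :: q') (+) weakly_left v (u' :: q')) =
  ~~ (start_lt u u' (+) end_lt v v' (+) (below v u' (+) below v' u)).
Proof.
move=> pq pq' d.
wlog h : u q u' q' pq pq' d / forall c c', curve pos (u :: q) c ->
    curve pos (u' :: q') c' -> c.2 = c'.2 -> c.1 < c'.1.
  move=> W; have [h|h] := paths_noncrossing dr pq pq' d; first exact: W.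
  move=> v v'.
  have d' z : z \in u' :: q' -> z \notin u :: q.
    by move=> zq'; apply/negP => /d; rewrite zq'.
  have := W u' q' u q pq' pq d' _; rewrite -/v -/v' => /(_ _).
  rewrite addbC => ->; last by move=> c c' h1 h2 h3; exact: h.
  have uu : u != u' by apply/eqP => uu; have := d u (mem_head _ _); rewrite uu mem_head.
  have vv : v != v'.
    by apply/eqP => vv; have := d v (mem_last _ _); rewrite vv mem_last.
  rewrite (start_ltC uu) (end_ltC vv) [below v' u (+) _]addbC.
  by case: (start_lt _ _); case: (end_lt _ _); do 2 case: (below _ _).
move=> v v'.
have cu : curve pos (u :: q) (pos u) by apply: curve_vertex; exact: mem_head.
have cv : curve pos (u :: q) (pos v) by apply: curve_vertex; exact: mem_last.
have cu' : curve pos (u' :: q') (pos u') by apply: curve_vertex; exact: mem_head.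
have cv' : curve pos (u' :: q') (pos v') by apply: curve_vertex; exact: mem_last.
have nleft w : curve pos (u' :: q') (pos w) -> weakly_left w (u :: q) = false.
  move=> cw; apply/asboolP => -[c cc [c2 c1]].
  by have := h _ _ cc cw c2; rewrite ltNge c1.
have isleft w : curve pos (u :: q) (pos w) ->
    weakly_left w (u' :: q') = ((pos u').2 <= (pos w).2 <= (pos v').2).
  move=> cw; apply/asboolP/idP => [[c cc [<- _]]|hw].
    exact: (curve_height up pq' cc).
  have [c cc c2] := curve_cover pq' hw.
  by exists c => //; split=> //; apply/ltW/h.
rewrite !nleft// !isleft//.
have uv : (pos u).2 <= (pos v).2 by case/andP: (curve_height up pq cv).
have uv' : (pos u').2 <= (pos v').2 by case/andP: (curve_height up pq' cv').
have hu : (pos u).2 = (pos u').2 -> (pos u).1 < (pos u').1 by exact: h.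
have hv : (pos v).2 = (pos v').2 -> (pos v).1 < (pos v').1 by exact: h.
(* With the first path on the left, a tie in height makes [start_lt] false and [end_lt] true, so
   both reduce to comparisons of heights, one strict and one weak. *)
have -> : start_lt u u' = ((pos u).2 < (pos u').2).
  rewrite /start_lt; case: ltgtP => //= /hu; by case: ltgtP.
have -> : end_lt v v' = ((pos v).2 <= (pos v').2).
  by rewrite /end_lt; case: ltgtP => //= /hv ->.
rewrite /below.
case: (leP (pos u').2 (pos u).2) => h1; case: (leP (pos u').2 (pos v).2) => h2;
case: (leP (pos u).2 (pos v').2) => h3; case: (leP (pos v).2 (pos v').2) => h4 //=;
exfalso; lra.
Qed.

End WeaklyLeft.

(** * Cancellation of intersecting families *)

Section Splice.
Variable T : eqType.
Implicit Types (x y : T) (p s : seq T).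

Definition splice x p p' := take (index x p) p ++ drop (index x p') p'.

Lemma splice_pivot x s1 s2 s1' s2' : x \notin s1 -> x \notin s1' ->
  splice x (s1 ++ x :: s2) (s1' ++ x :: s2') = s1 ++ x :: s2'.
Proof.
by move=> h h'; rewrite /splice take_pivot// index_pivot// drop_size_cat.
Qed.

Lemma mem_pivot x p : x \in p ->
  exists s1 s2, p = s1 ++ x :: s2 /\ x \notin s1.
Proof.
move=> xp; exists (take (index x p) p), (drop (index x p).+1 p).
by rewrite -drop_index// cat_take_drop in_take// ltnn.
Qed.

End Splice.

Lemma bigD2 (R : Type) (idx : R) (op : Monoid.com_law idx) (I : finType)
    (i j : I) (f : I -> R) : i != j ->
  \big[op/idx]_k f k =
  op (op (f i) (f j)) (\big[op/idx]_(k | (k != i) && (k != j)) f k).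
Proof.
move=> ij; rewrite (bigD1 i)//= (bigD1 j) 1?eq_sym//=.
by rewrite Monoid.mulmA.
Qed.

Section PathDeterminant.
Variables (T : finType) (e : rel T).
Hypothesis acyc : forall p, path.cycle e p -> p = [::].

Lemma is_path_cat a b x s1 s2 : is_path e a b (s1 ++ x :: s2) =
  is_path e a x (rcons s1 x) && is_path e x b (x :: s2).
Proof.
case: s1 => [|y s1] /=; first by rewrite !eqxx andbT.
by rewrite cat_path last_cat last_rcons rcons_path /= !eqxx !andbT -!andbA.
Qed.

Lemma is_path_uniq a b p : is_path e a b p -> uniq p.
Proof. by case: p => // x q /and3P[_ pq _]; exact: path_uniq pq. Qed.

Lemma is_path_size a b p : is_path e a b p -> (size p <= #|T|)%N.
Proof. by move=> /is_path_uniq/card_uniqP<-; exact: max_card. Qed.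

Variables (R : comPzRingType) (F : seq T -> R).
(** The cancellation asks no more of [F] than this. Signed weights need not be multiplicative,
    because the common vertex contributes a sign of its own. *)
Hypothesis F_swap : forall a b a' b' x s1 s2 s1' s2',
  is_path e a b (s1 ++ x :: s2) -> is_path e a' b' (s1' ++ x :: s2') ->
  F (s1 ++ x :: s2') * F (s1' ++ x :: s2) = F (s1 ++ x :: s2) * F (s1' ++ x :: s2').

Variables (n : nat) (u v : 'I_n -> T).
Implicit Types (P : {ffun 'I_n -> vpath T}) (sigma : 'S_n) (i j k : 'I_n).

Definition hits P x : pred 'I_n := fun k => x \in bseqval (P k).

(* The first vertex on at least two paths, with the first two paths through it.
   Exchanging tails preserves the number of paths through each vertex, and hence
   this choice. *)
Definition crossing P : option (T * 'I_n * 'I_n) :=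
  if [pick x | 1 < #|hits P x|]%N is Some x then
    if [pick i | hits P x i] is Some i then
      if [pick j | (j != i) && hits P x j] is Some j then Some (x, i, j) else None
    else None
  else None.

Lemma crossing_some P x i j : crossing P = Some (x, i, j) ->
  [/\ i != j, hits P x i & hits P x j].
Proof.
rewrite /crossing; case: pickP => // y _; case: pickP => // k hk.
by case: pickP => // l /andP[lk hl] [<- <- <-]; rewrite eq_sym.
Qed.

Lemma crossing_none P : (crossing P == None) = nonintersecting P.
Proof.
apply/idP/idP.
- rewrite /crossing; case: pickP => [y hy|h _].
    have [i hi] : exists i, hits P y i.
      by case/card_gt0P: (ltnW hy) => i; exists i.
    case: pickP => [k hk|/(_ i)]; last by rewrite hi.
    case: pickP => // h _.
    have : (#|hits P y| <= #|pred1 k|)%N.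
      apply/subset_leq_card/fintype.subsetP => j hj; rewrite inE.
      by apply: contraFT (h j) => ->.
    by rewrite card1 leqNgt hy.
  apply/forallP => i; apply/forallP => j; apply/implyP => ij.
  rewrite disjoint_has; apply/hasPn => x xi; apply/negP => xj.
  suff : (1 < #|hits P x|)%N by rewrite h.
  by apply/card_gt1P; exists i, j; split.
- move=> /forallP h; case E : (crossing P) => [[[x i] j]|] //.
  have [ij hi hj] := crossing_some E.
  have /forallP/(_ j) := h i; rewrite ij /= disjoint_has => /hasPn/(_ _ hi).
  by rewrite /= /hits in hj *; rewrite hj.
Qed.

(** [insub_bseq] gives a default value on a sequence that is too long; at a common vertex both
    results are again paths, and acyclicity bounds their size. *)
Definition swap_tails x i j P : {ffun 'I_n -> vpath T} :=
  [ffun k => if k == i then insub_bseq _ (splice x (P i) (P j))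
    else if k == j then insub_bseq _ (splice x (P j) (P i)) else P k].

Lemma swap_tailsP sigma P x i j : i != j -> hits P x i -> hits P x j ->
  P \in families_of_type e u v sigma ->
  exists s1 s2 s1' s2',
    [/\ bseqval (P i) = s1 ++ x :: s2, bseqval (P j) = s1' ++ x :: s2',
    x \notin s1, x \notin s1' & [/\ bseqval (swap_tails x i j P i) = s1 ++ x :: s2',
    bseqval (swap_tails x i j P j) = s1' ++ x :: s2,
    is_path e (u i) (v (sigma j)) (s1 ++ x :: s2'),
    is_path e (u j) (v (sigma i)) (s1' ++ x :: s2) &
    forall k, k != i -> k != j -> swap_tails x i j P k = P k]].
Proof.
move=> ij /mem_pivot[s1 [s2 [Pi n1]]] /mem_pivot[s1' [s2' [Pj n1']]].
rewrite inE => /forallP hP.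
have := hP i; have := hP j; rewrite !inE Pi Pj !is_path_cat.
move=> /andP[a1 b1] /andP[a2 b2].
have p1 : is_path e (u i) (v (sigma j)) (s1 ++ x :: s2') by rewrite is_path_cat a2.
have p2 : is_path e (u j) (v (sigma i)) (s1' ++ x :: s2) by rewrite is_path_cat a1.
exists s1, s2, s1', s2'; split=> //; split=> //.
- rewrite ffunE eqxx Pi Pj splice_pivot// -[LHS]/(val _) insubdK//.
  exact: is_path_size p1.
- rewrite ffunE eq_sym (negPf ij) eqxx Pi Pj splice_pivot// -[LHS]/(val _) insubdK//.
  exact: is_path_size p2.
- by move=> k ki kj; rewrite ffunE (negPf ki) (negPf kj).
Qed.

Lemma card_hits P x : #|hits P x| = (\sum_k (x \in bseqval (P k)))%N.
Proof.
rewrite -sum1_card big_mkcond; apply: eq_bigr => k _.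
by rewrite unfold_in /hits; case: ifP.
Qed.

Lemma family_path sigma P k : P \in families_of_type e u v sigma ->
  is_path e (u k) (v (sigma k)) (P k).
Proof. by rewrite inE => /forallP/(_ k); rewrite inE. Qed.

Lemma swap_tails_family sigma P x i j : i != j -> hits P x i -> hits P x j ->
  P \in families_of_type e u v sigma ->
  swap_tails x i j P \in families_of_type e u v (tperm i j * sigma)%g.
Proof.
move=> ij hi hj hP.
have [s1 [s2 [s1' [s2' [_ _ _ _ [Ei Ej p1 p2 Ek]]]]]] := swap_tailsP ij hi hj hP.
rewrite inE; apply/forallP => k; rewrite inE permM.
case: tpermP => [->|->|/eqP ki /eqP kj]; rewrite ?Ei ?Ej//.
by rewrite Ek//; exact: family_path.
Qed.

Lemma swap_tails_crossing sigma P x i j : i != j -> hits P x i -> hits P x j ->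
  P \in families_of_type e u v sigma ->
  crossing P = Some (x, i, j) -> crossing (swap_tails x i j P) = Some (x, i, j).
Proof.
move=> ij hi hj hP.
have hP' := swap_tails_family ij hi hj hP.
have [s1 [s2 [s1' [s2' [Pi Pj _ _ [Ei Ej _ _ Ek]]]]]] := swap_tailsP ij hi hj hP.
set P' := swap_tails x i j P in hP' Ei Ej Ek *.
have card_eq y : #|hits P' y| = #|hits P y|.
  rewrite !card_hits (bigD2 _ _ ij) [RHS](bigD2 _ _ ij) /=; congr addn; last first.
    by apply: eq_bigr => k /andP[ki kj]; rewrite Ek.
  (* The vertices of a path are distinct, so membership is a multiplicity, which is additive under
     concatenation. *)
  rewrite -!count_uniq_mem; try exact: is_path_uniq (family_path _ hP);
    try exact: is_path_uniq (family_path _ hP').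
  by rewrite Ei Ej Pi Pj !count_cat /= addnACA [RHS]addnACA [X in (_ + X)%N]addnC.
have hits_eq k : hits P' x k = hits P x k.
  have [->|ki] := eqVneq k i; first by rewrite hi /hits Ei mem_cat mem_head orbT.
  have [->|kj] := eqVneq k j; first by rewrite hj /hits Ej mem_cat mem_head orbT.
  by rewrite /hits Ek.
move=> E; rewrite -E; move: E; rewrite /crossing.
have -> : [pick y | 1 < #|hits P' y|]%N = [pick y | 1 < #|hits P y|]%N.
  by apply: eq_pick => y; rewrite card_eq.
case: pickP => // y _ E.
have yx : y = x by move: E; case: pickP => // k _; case: pickP => // l _ [].
rewrite yx (eq_pick hits_eq); case: pickP => // k _.
by rewrite (@eq_pick _ _ [pred l | (l != k) && hits P x l])// => l; rewrite /= hits_eq.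
Qed.

Lemma swap_tailsK sigma P x i j : i != j -> hits P x i -> hits P x j ->
  P \in families_of_type e u v sigma -> swap_tails x i j (swap_tails x i j P) = P.
Proof.
move=> ij hi hj hP.
have [s1 [s2 [s1' [s2' [Pi Pj n1 n1' [Ei Ej _ _ Ek]]]]]] := swap_tailsP ij hi hj hP.
apply/ffunP => k; rewrite ffunE.
have [->|ki] := eqVneq k i.
  rewrite Ei Ej splice_pivot// -Pi; apply: val_inj.
  by rewrite insubdK//; exact: is_path_size (family_path _ hP).
have [->|kj] := eqVneq k j.
  rewrite Ei Ej splice_pivot// -Pj; apply: val_inj.
  by rewrite insubdK//; exact: is_path_size (family_path _ hP).
exact: Ek.
Qed.

Lemma swap_tails_weight sigma P x i j : i != j -> hits P x i -> hits P x j ->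
  P \in families_of_type e u v sigma ->
  \prod_k F (swap_tails x i j P k) = \prod_k F (P k).
Proof.
move=> ij hi hj hP.
have [s1 [s2 [s1' [s2' [Pi Pj n1 n1' [Ei Ej _ _ Ek]]]]]] := swap_tailsP ij hi hj hP.
rewrite (bigD2 _ _ ij) [RHS](bigD2 _ _ ij) /=; congr (_ * _); last first.
  by apply: eq_bigr => k /andP[ki kj]; rewrite Ek.
rewrite Ei Ej Pi Pj; apply: F_swap; first by rewrite -Pi; exact: family_path hP.
by rewrite -Pj; exact: family_path hP.
Qed.

(** Exchanging tails at the chosen crossing is an involution [theta] that keeps the weight and
    changes the parity of the type. *)
Lemma intersecting_cancel :
  \sum_(z : 'S_n * {ffun 'I_n -> vpath T}
    | (z.2 \in families_of_type e u v z.1) && ~~ nonintersecting z.2)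
    (-1) ^+ z.1 * \prod_k F (z.2 k) = 0.
Proof.
pose theta (z : 'S_n * {ffun 'I_n -> vpath T}) :=
  if crossing z.2 is Some (x, i, j)
  then (tperm i j * z.1, swap_tails x i j z.2)%g else z.
pose Q (z : 'S_n * {ffun 'I_n -> vpath T}) :=
  (z.2 \in families_of_type e u v z.1) && ~~ nonintersecting z.2.
have thetaP z : Q z -> [/\ Q (theta z), theta (theta z) = z,
    odd_perm (theta z).1 = ~~ odd_perm z.1 &
    \prod_k F ((theta z).2 k) = \prod_k F (z.2 k)].
  case: z => sigma P /andP[/= hP]; rewrite -crossing_none.
  case E : (crossing P) => [[[x i] j]|] // _.
  have [ij hi hj] := crossing_some E.
  have E' := swap_tails_crossing ij hi hj hP E.
  have -> : theta (sigma, P) = (tperm i j * sigma, swap_tails x i j P)%g.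
    by rewrite /theta /= E.
  split=> /=.
  - by rewrite /Q /= (swap_tails_family ij hi hj hP) -crossing_none E'.
  - by rewrite /theta /= E' (swap_tailsK ij hi hj hP) mulgA tperm2 mul1g.
  - by rewrite odd_permM odd_tperm ij.
  - exact: swap_tails_weight hP.
(* Pairing even with odd types avoids dividing by 2. *)
rewrite (eq_bigl Q)// (bigID (fun z => odd_perm z.1)).
rewrite (reindex_onto theta theta); last by move=> z /andP[/thetaP[]].
rewrite (eq_bigl (fun z => Q z && ~~ odd_perm z.1)); last first.
  move=> z; apply/idP/idP.
    move=> /andP[/andP[/thetaP[q1 _ q3 _] q4] /eqP q5].
    by rewrite -q5 q1 q3 q4.
  by move=> /andP[/thetaP[-> -> -> _] ->]; rewrite eqxx.
rewrite -big_split big1//= => z /andP[/thetaP[_ _ -> ->] h].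
by rewrite (negPf h) /= expr0 expr1 mulN1r mul1r addNr.
Qed.

(** Distributivity turns each product of sums into a sum over families, of which the intersecting
    ones cancel. *)
Lemma path_determinant :
  \sum_(sigma : 'S_n) (-1) ^+ sigma *
    \prod_i \sum_(p in paths e (u i) (v (sigma i))) F p =
  \sum_(sigma : 'S_n) (-1) ^+ sigma *
    \sum_(P in families_of_type0 e u v sigma) \prod_i F (P i).
Proof.
have -> : \sum_(sigma : 'S_n) (-1) ^+ sigma *
    \prod_i \sum_(p in paths e (u i) (v (sigma i))) F p =
  \sum_(sigma : 'S_n) \sum_(P in families_of_type e u v sigma)
    (-1) ^+ sigma * \prod_i F (P i).
  apply: eq_bigr => sigma _; rewrite bigA_distr_big_dep mulr_sumr.
  by apply: eq_bigl => P; rewrite [in RHS]inE; apply/familyP/forallP.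
rewrite pair_big_dep (bigID (fun z => nonintersecting z.2)) /=.
rewrite intersecting_cancel addr0.
under [RHS]eq_bigr do rewrite mulr_sumr.
by rewrite pair_big_dep; apply: eq_bigl => z; rewrite [in RHS]inE.
Qed.

End PathDeterminant.

(** * The sign of a non-intersecting family *)

Section Signs.
Variable R : comPzRingType.
Implicit Types (b : bool).

Definition is_sign (x : R) := x = 1 \/ x = -1.

Lemma is_signM x y : is_sign x -> is_sign y -> is_sign (x * y).
Proof.
by move=> [->|->] [->|->]; rewrite ?mul1r ?mulN1r ?opprK; [left|right|right|left].
Qed.

Lemma is_sign_bool b : is_sign ((-1) ^+ b).
Proof. by case: b; [right; rewrite expr1 | left; rewrite expr0]. Qed.

Lemma is_sign_prod (I : finType) (Q : pred I) (f : I -> R) :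
  (forall i, is_sign (f i)) -> is_sign (\prod_(i | Q i) f i).
Proof. by move=> h; apply: big_ind => // [|x y]; [left | exact: is_signM]. Qed.

Lemma is_sign_sq x : is_sign x -> x * x = 1.
Proof. by case=> ->; rewrite ?mul1r // mulN1r opprK. Qed.

Lemma sign_card (I : finType) (b : pred I) :
  (-1) ^+ #|b| = \prod_i (-1) ^+ (b i) :> R.
Proof.
rewrite -prodr_const big_mkcond; apply: eq_bigr => i _.
by rewrite unfold_in; case: (b i).
Qed.

Lemma sign_neg b : (-1) ^+ (~~ b) = - (-1) ^+ b :> R.
Proof. by case: b; rewrite /= ?expr0 ?expr1 ?opprK. Qed.

(** Groups the factors by unordered pairs, since the parity for disjoint paths is known only for
    both paths of a pair together. *)
Lemma prod_pairs n (X : 'I_n -> 'I_n -> R) :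
  \prod_i \prod_k X i k =
  (\prod_i X i i) * \prod_(i < n) \prod_(k < n | (i < k)%N) (X i k * X k i).
Proof.
have -> : \prod_i \prod_k X i k =
    \prod_(i < n) (X i i *
      (\prod_(k < n | (i < k)%N) X i k * \prod_(k < n | (k < i)%N) X i k)).
  apply: eq_bigr => i _; rewrite (bigD1 i)//=; congr (_ * _).
  rewrite (bigID (fun k : 'I_n => (i < k)%N)) /=; congr (_ * _); apply: eq_bigl => k.
    by rewrite andb_idl// => ik; rewrite -val_eqE /= gtn_eqF.
  by rewrite -leqNgt ltn_neqAle val_eqE.
rewrite !big_split /=; congr (_ * _).
under [in RHS]eq_bigr do rewrite big_split.
rewrite big_split /=; congr (_ * _).
by rewrite (exchange_big_dep xpredT).
Qed.

(* A Vandermonde determinant in the ranks counts the inversions of a permutation. *)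
Lemma sign_inversions n (lt : rel 'I_n) (sigma : 'S_n) :
  transitive lt -> (forall i j, i != j -> lt j i = ~~ lt i j) ->
  \prod_(i < n) \prod_(j < n | (i < j)%N) (-1) ^+ lt (sigma i) (sigma j) =
  (-1) ^+ sigma * \prod_(i < n) \prod_(j < n | (i < j)%N) (-1) ^+ lt i j :> R.
Proof.
move=> tr anti.
(* The rank decreases along [lt], so that differences of ranks have the signs wanted. The condition
   [j != i] is there because nothing is known about [lt i i]. *)
pose r i : int := #|[pred j | lt i j && (j != i)]|%:Z.
have rlt i j : i != j -> lt i j -> r j < r i.
  move=> ij lij; rewrite ltz_nat; apply/proper_card/properP; split.
    apply/fintype.subsetP => k; rewrite !inE => /andP[jk kj].
    rewrite (tr _ _ _ lij jk) /=; apply: contraTneq lij => <-.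
    by rewrite (anti j k) ?jk// eq_sym.
  by exists j; rewrite inE ?lij 1?eq_sym// eqxx andbF.
have sg i j : i != j -> Num.sg (r j - r i) = (-1) ^+ lt i j.
  move=> ij; case E : (lt i j).
    by rewrite ltr0_sg ?expr1// subr_lt0 rlt.
  by rewrite gtr0_sg ?expr0// subr_gt0 rlt 1?eq_sym// anti// E.
have V (f : 'I_n -> 'I_n) : injective f ->
    Num.sg (\det (Vandermonde n (\row_i r (f i)))) =
    \prod_(i < n) \prod_(j < n | (i < j)%N) (-1) ^+ lt (f i) (f j).
  move=> fi; rewrite det_Vandermonde (big_morph _ (@sgrM _) (sgr1 _)).
  apply: eq_bigr => i _; rewrite (big_morph _ (@sgrM _) (sgr1 _)).
  apply: eq_bigr => j ij; rewrite !mxE sg// (inj_eq fi).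
  by rewrite -val_eqE /= ltn_eqF.
have := V sigma perm_inj.
have -> : Vandermonde n (\row_i r (sigma i)) =
    col_perm sigma (Vandermonde n (\row_i r i)).
  by apply/matrixP => i j; rewrite !mxE.
rewrite col_permE det_mulmx det_perm sgrM (V id)//.
rewrite odd_permV.
have -> : Num.sg ((-1) ^+ sigma : int) = (-1) ^+ sigma.
  by rewrite sgrX sgrN1.
(* The identity has been found for signs in [int]. Collecting the exponents modulo 2 turns it into
   one of booleans, which passes to any [R], even if 1 and -1 coincide there. *)
pose addp (f : 'I_n -> 'I_n -> bool) :=
  \big[addb/false]_(i < n) \big[addb/false]_(j < n | (i < j)%N) f i j.
have prodE (S : comPzRingType) (f : 'I_n -> 'I_n -> bool) :
    \prod_(i < n) \prod_(j < n | (i < j)%N) (-1) ^+ f i j =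
    (-1) ^+ addp f :> S.
  have m0 : (-1) ^+ false = 1 :> S by [].
  rewrite (big_morph (fun b : bool => (-1) ^+ b : S) (@signr_addb S) m0).
  apply: eq_bigr => i _.
  by rewrite (big_morph (fun b : bool => (-1) ^+ b : S) (@signr_addb S) m0).
rewrite !prodE -!signr_addb => /signr_inj h.
by rewrite -h addbC.
Qed.

End Signs.

Section SignedPaths.
Variables (K : realType) (T : finType) (e : rel T) (s t : T) (pos : T -> K * K).
Hypothesis hst : st_digraph e s t.
Hypothesis dr : upward_planar_drawing e pos.
Variables (R : comPzRingType) (n : nat) (u v : 'I_n -> T).
Hypothesis v_inj : injective v.
Implicit Types (a b x : T) (p : seq T).

Definition mark_sign (f : T -> bool) : R :=
  (\prod_k (-1) ^+ f (u k)) * (\prod_k (-1) ^+ f (v k)).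

Lemma mark_signD f g : mark_sign (fun w => f w (+) g w) = mark_sign f * mark_sign g.
Proof.
rewrite /mark_sign mulrACA; congr (_ * _); rewrite -big_split;
by apply: eq_bigr => k _; rewrite signr_addb.
Qed.

Lemma mark_sign_is_sign f : is_sign (mark_sign f).
Proof. by apply: is_signM; apply: is_sign_prod => k; exact: is_sign_bool. Qed.

Lemma eq_mark_sign f g : f =1 g -> mark_sign f = mark_sign g.
Proof. by move=> fg; congr (_ * _); apply: eq_bigr => k _; rewrite fg. Qed.

Definition left_sign p : R := mark_sign (fun w => weakly_left pos w p).

(** The part of the path sign due to completing the path down to [s], corrected for the common
    vertex [a]; it depends on the start alone. *)
Definition start_sign a : R := mark_sign (fun w =>
  weakly_left pos w (leftmost_path e pos s a) (+) weakly_left pos w [:: a]).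

Definition end_sign b : R := mark_sign (fun w =>
  weakly_left pos w (leftmost_path e pos b t) (+) weakly_left pos w [:: b]).

Lemma path_signE a b p : is_path e a b p ->
  path_sign e s t pos u v R a b p = start_sign a * end_sign b * left_sign p.
Proof.
move=> ab; rewrite /path_sign /num_left exprD !sign_card.
rewrite -!mark_signD /mark_sign.
by congr (_ * _); apply: eq_bigr => k _; rewrite /= (left_side_addb hst dr _ ab).
Qed.

Lemma left_sign_pivot a b x s1 s2 : is_path e a b (s1 ++ x :: s2) ->
  left_sign (s1 ++ x :: s2) =
  left_sign (rcons s1 x) * left_sign (x :: s2) * left_sign [:: x].
Proof.
move=> ab; rewrite -!mark_signD; apply: eq_mark_sign => w.
move: ab; rewrite is_path_cat; case: s1 => [|y s1] /=.
  by move=> _; rewrite addbAC addbb.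
move=> /andP[/and3P[_ p1 _] /and3P[_ p2 _]].
have := @weakly_left_cat _ _ _ _ _ pos hst dr w y (rcons s1 x) s2 p1.
by rewrite last_rcons cat_rcons => /(_ p2).
Qed.

Lemma path_weight_pivot (wt : T -> T -> R) x s1 s2 :
  path_weight wt (s1 ++ x :: s2) =
  path_weight wt (rcons s1 x) * path_weight wt (x :: s2).
Proof.
rewrite /path_weight; case: s1 => [|y s1] /=.
  by rewrite {2}/steps /= big_nil mul1r.
by rewrite -cat_rcons steps_cat last_rcons big_cat.
Qed.

(** The value shared by all non-intersecting families once the sign of the type is included. The
    minus is the constant 1 in the parity for two disjoint paths; the last product runs over all
    pairs, so it does not see which end belongs to which start. *)
Definition family_sign : R :=
  (\prod_(i < n) \prod_(k < n | (i < k)%N) (- (-1) ^+ start_lt pos (u i) (u k))) *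
  (\prod_(i < n) \prod_(k < n | (i < k)%N) (-1) ^+ end_lt pos (v i) (v k)) *
  (\prod_(i < n) \prod_(k < n) (-1) ^+ below pos (v i) (u k)).

Lemma family_sign_is_sign : is_sign family_sign.
Proof.
apply: is_signM; first apply: is_signM; apply: is_sign_prod => i;
  apply: is_sign_prod => k; rewrite -?sign_neg; exact: is_sign_bool.
Qed.

Lemma weakly_left_mem w p : w \in p -> weakly_left pos w p.
Proof. by move=> wp; apply/asboolP; apply: sub_leftward; exact: curve_vertex. Qed.

Lemma nonintersecting_sign (sigma : 'S_n) (P : {ffun 'I_n -> vpath T}) :
  P \in families_of_type e u v sigma -> nonintersecting P ->
  (-1) ^+ sigma * \prod_i left_sign (P i) = family_sign.
Proof.
move=> hP nP.
have /choice[q Pq] : forall i, exists q,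
    [/\ bseqval (P i) = u i :: q, path e (u i) q & last (u i) q = v (sigma i)].
  move=> i; have := family_path i hP; case: (bseqval (P i)) => // x q.
  by move=> /and3P[/eqP-> pq /eqP lq]; exists q.
pose wl (k i : 'I_n) := weakly_left pos (u k) (P i).
pose wl' (k i : 'I_n) := weakly_left pos (v k) (P i).
(* Contribution of the two ends of path [k] to the sign of path [i]; the index [sigma k] brings the
   marked points of one path together. *)
pose X (i k : 'I_n) : R := (-1) ^+ wl k i * (-1) ^+ wl' (sigma k) i.
pose Y (i k : 'I_n) : R := (-1) ^+ below pos (v (sigma i)) (u k).
have -> : \prod_i left_sign (P i) = \prod_i \prod_k X i k.
  apply: eq_bigr => i _; rewrite big_split /=; congr (_ * _).
  by rewrite (reindex_inj (@perm_inj _ sigma)).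
have X1 i : X i i = 1.
  have [PE pq lq] := Pq i; rewrite /X /wl /wl' PE !weakly_left_mem.
  - by rewrite expr1 mulrNN mulr1.
  - by rewrite -lq mem_last.
  - by rewrite mem_head.
have Y1 i : Y i i = 1.
  have [PE pq lq] := Pq i; rewrite /Y /below -lq ltNge (connect_height dr).
    by rewrite expr0.
  by apply/connectP; exists (q i).
have XX (i k : 'I_n) : (i < k)%N -> X i k * X k i = - (-1) ^+ start_lt pos (u i) (u k) *
    (-1) ^+ end_lt pos (v (sigma i)) (v (sigma k)) * (Y i k * Y k i).
  move=> ik; have ik' : i != k by rewrite -val_eqE /= ltn_eqF.
  have [PEi pi li] := Pq i; have [PEk pk lk] := Pq k.
  have d z : z \in u i :: q i -> z \notin u k :: q k.
    rewrite -PEi -PEk => zi; apply/negP => zk.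
    move/forallP: nP => /(_ i)/forallP/(_ k); rewrite ik' /= disjoint_has.
    by move=> /hasPn/(_ _ zi); rewrite /= zk.
  have := disjoint_paths_parity dr pi pk d.
  rewrite /= li lk -PEi -PEk => h.
  rewrite /X /Y -!signr_addb -sign_neg -!signr_addb; congr (_ ^+ nat_of_bool _).
  rewrite /wl /wl' h; case: (start_lt _ _ _); case: (end_lt _ _ _);
    by do 2 case: (below _ _ _).
rewrite prod_pairs big1 ?mul1r//.
have -> : \prod_(i < n) \prod_(k < n | (i < k)%N) (X i k * X k i) =
    \prod_(i < n) \prod_(k < n | (i < k)%N) (- (-1) ^+ start_lt pos (u i) (u k)) *
    (\prod_(i < n) \prod_(k < n | (i < k)%N)
      (-1) ^+ end_lt pos (v (sigma i)) (v (sigma k)) *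
    \prod_(i < n) \prod_(k < n | (i < k)%N) (Y i k * Y k i)).
  rewrite -!big_split; apply: eq_bigr => i _; rewrite -!big_split.
  by apply: eq_bigr => k ik; rewrite XX//= -mulrA.
(* No end is below its own start, so the diagonal factors are 1 and the pairs fill up to a full
   product, in which [sigma] is absorbed by reindexing. *)
have -> : \prod_(i < n) \prod_(k < n | (i < k)%N) (Y i k * Y k i) =
    \prod_(i < n) \prod_(k < n) (-1) ^+ below pos (v i) (u k).
  rewrite [RHS](reindex_inj (@perm_inj _ sigma)) /= -/(Y _ _).
  by rewrite (prod_pairs Y) [X in _ = X * _]big1 ?mul1r.
rewrite (sign_inversions R sigma (lt := fun i k => end_lt pos (v i) (v k))).
- rewrite /family_sign [LHS]mulrCA -[RHS]mulrA; congr (_ * _).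
  by rewrite !mulrA (is_sign_sq (is_sign_bool R _)) mul1r.
- by move=> i j k; exact: end_lt_trans.
- by move=> i j ij; rewrite (end_ltC dr) ?(inj_eq v_inj).
Qed.

End SignedPaths.

(** A family determines its type: its [i]-th path ends at [v (sigma i)], and [v] is injective. *)
Lemma GF_families0 (T : finType) (eG : rel T) (R : comPzRingType) (wt : T -> T -> R)
    (n : nat) (u v : 'I_n -> T) : injective v ->
  GF wt (families0 eG u v) = \sum_(sigma : 'S_n) GF wt (families_of_type0 eG u v sigma).
Proof.
move=> v_inj; rewrite /GF.
rewrite (exchange_big_dep (mem (families0 eG u v))) /=; last first.
  move=> sigma P _; rewrite inE => /andP[hP nP]; rewrite inE nP andbT.
  by apply/finset.bigcupP; exists sigma.
apply: eq_bigr => P; rewrite inE => /andP[/finset.bigcupP[sigma _ hP] nP].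
rewrite (big_pred1 sigma)// => tau /=; rewrite [LHS]inE nP andbT.
apply/idP/eqP => [hP'|->//]; apply/permP => i; apply: v_inj.
have := family_path i hP; have := family_path i hP'.
by case: (bseqval (P i)) => // x q /and3P[_ _ /eqP<-] /and3P[_ _ /eqP<-].
Qed.

Theorem theorem2p4 (K : realType) (T : finType) (e : rel T) (s t : T)
    (pos : T -> K * K) (hst : st_planar e s t pos)
    (A : {set T}) (eG : rel T) (hG : subgraph e A eG)
    (R : comPzRingType) (wt : T -> T -> R)
    (n : nat) (u v : 'I_n -> T)
    (u_inj : injective u) (v_inj : injective v)
    (uA : forall i, u i \in A) (vA : forall i, v i \in A) :
  GF wt (families0 eG u v) = \sum_(sigma : 'S_n) GF wt (families_of_type0 eG u v sigma)
  /\ exists eps : R, (eps = 1 \/ eps = -1) /\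
     GF wt (families0 eG u v) = eps * \det (signed_path_matrix e s t pos eG wt u v).
Proof.
split; first exact: GF_families0.
have [hdi dr _ _] := hst; have sub := subgraph_edge hG.
have acycG p : path.cycle eG p -> p = [::].
  by move=> /(sub_cycle sub); exact: (st_acyclic hdi).
have pathG a b p : is_path eG a b p -> is_path e a b p.
  by case: p => // x q /and3P[h1 /(sub_path sub) h2 h3]; apply/and3P; split.
pose S p := left_sign pos R u v p.
pose F p := S p * path_weight wt p.
have F_swap a b a' b' x s1 s2 s1' s2' : is_path eG a b (s1 ++ x :: s2) ->
    is_path eG a' b' (s1' ++ x :: s2') ->
    F (s1 ++ x :: s2') * F (s1' ++ x :: s2) = F (s1 ++ x :: s2) * F (s1' ++ x :: s2').
  move=> h h'; have := h; have := h'; rewrite !is_path_cat.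
  move=> /andP[a1' b1'] /andP[a1 b1].
  have k : is_path eG a b' (s1 ++ x :: s2') by rewrite is_path_cat a1.
  have k' : is_path eG a' b (s1' ++ x :: s2) by rewrite is_path_cat a1'.
  rewrite /F /S !path_weight_pivot.
  have pivot a0 b0 x0 r1 r2 (hr : is_path eG a0 b0 (r1 ++ x0 :: r2)) :=
    left_sign_pivot hdi dr R u v (pathG _ _ _ hr).
  (* Each side becomes a product over the same four half-paths, with the sign of the vertex [x]
     squared. *)
  rewrite (pivot _ _ _ _ _ h) (pivot _ _ _ _ _ h').
  rewrite (pivot _ _ _ _ _ k) (pivot _ _ _ _ _ k').
  ring.
(* Every family uses each start and each end once, whatever its type, so these signs multiply to a
   constant. *)
pose C := (\prod_i start_sign e s pos R u v (u i)) * (\prod_i end_sign e t pos R u v (v i)).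
pose D := family_sign pos R u v.
have CD : is_sign (C * D).
  apply: is_signM; last exact: family_sign_is_sign.
  by apply: is_signM; apply: is_sign_prod => i; exact: mark_sign_is_sign.
have detE : \det (signed_path_matrix e s t pos eG wt u v) =
    C * D * GF wt (families0 eG u v).
  rewrite GF_families0// /determinant.
  (* In each term [D] is replaced by the sign of the type times the signs [S] of the paths. *)
  have -> : C * D * \sum_(sigma : 'S_n) GF wt (families_of_type0 eG u v sigma) =
      C * \sum_(sigma : 'S_n) (-1) ^+ sigma *
        \sum_(P in families_of_type0 eG u v sigma) \prod_i F (P i).
    rewrite -mulrA; congr (_ * _); rewrite mulr_sumr; apply: eq_bigr => sigma _.
    rewrite /GF !mulr_sumr; apply: eq_bigr => P; rewrite inE => /andP[hP nP].
    rewrite big_split /= mulrA (nonintersecting_sign dr R v_inj _ nP)//.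
    by rewrite inE; apply/forallP => i; rewrite inE; apply: pathG; exact: family_path.
  rewrite -(path_determinant acycG F_swap) mulr_sumr; apply: eq_bigr => sigma _.
  rewrite mulrCA; congr (_ * _).
  rewrite /C [X in _ * X * _](reindex_inj (@perm_inj _ sigma)) -!big_split /=.
  apply: eq_bigr => i _; rewrite mxE mulr_sumr; apply: eq_bigr => p; rewrite inE => hp.
  by rewrite (path_signE hdi dr _ _ _ (pathG _ _ _ hp)) -mulrA.
exists (C * D); split; first exact: CD.
by rewrite detE mulrA is_sign_sq ?mul1r.
Qed.
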